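(* Let $A$ be the direct limit of a system $\bigl((A_n),(\varphi_{n_2,n_1})\bigr)$ of the form (V1)--(V10) described in the context, satisfying: (1) $m=2$ and $r_1(0)=r_2(0)=1$; (2) $X_1$ and $X_2$ are contractible; (3) all maps $\varphi_{n+1,n}$ are diagonal; (4) there are sequences $(c(n))_{n\ge1}$ and $(l(n))_{n\ge1}$ of positive integers such that for every $n\ge1$, $\mu_{1,1}(n)=\mu_{2,2}(n)=l(n)-c(n)$ and $\mu_{1,2}(n)=\mu_{2,1}(n)=c(n)$; (5) $l(n)\ge2c(n)+1$ for all $n\ge1$. For $n\ge0$ let $r(n)=\prod_{k=1}^n l(k)$ and $r'(n)=\prod_{k=1}^n[l(k)-2c(k)]$. Assume that for every positive integer $k$ there exist $n,n'\ge1$ with $k\mid r(n)$ and $k\mid r'(n')$, and that $c(n)>0$ for infinitely many $n$. Define $$\lambda=\prod_{n=1}^\infty\left(1-\frac{2c(n)}{l(n)}\right).$$ Equip $\mathbb{Q}\oplus\mathbb{Q}$ with the order in which $(x,y)$ is positive if and only if $(x,y)=(0,0)$ or $x>\lambda|y|$, and with the order unit $(1,0)$. Then the homomorphism $\gamma\colon K_0(A)\to\mathbb{Q}\oplus\mathbb{Q}$ defined in the context is an isomorphism of scaled ordered groups.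
   Context: The system. (V1) An integer $m\ge1$. (V2) Compact metric spaces $X_1,\dots,X_m$. (V3) For each $j$ a sequence $(d_j(n))_{n\ge1}$ of positive integers; $s_j(n)=\prod_{k=1}^n d_j(k)$, $s_j(0)=1$. (V4) For each $n\ge1$ a matrix $(\mu_{k,j}(n))_{j,k=1}^m$ of nonnegative integers with $1\le d_j(n)\le\mu_{j,j}(n)$. (V5) Positive integers $r_1(0),\dots,r_m(0)$, and $r_k(n+1)=\sum_{j=1}^m\mu_{k,j}(n+1)r_j(n)$. (V6) $\lim_{n\to\infty}r_j(n)=\infty$. (V7) $A_n=\bigoplus_{j=1}^m C(X_j^{s_j(n)},M_{r_j(n)})$ for $n\ge0$. (V8) Unital homomorphisms $\varphi_{n+1,n}\colon A_n\to A_{n+1}$, compositions $\varphi_{n_2,n_1}$, direct limit $A=\varinjlim A_n$ with canonical maps $\varphi_{\infty,n}\colon A_n\to A$, and partial maps $\varphi_{n_2,n_1}^{k,j}$ from the $j$-th summand of $A_{n_1}$ to the $k$-th summand of $A_{n_2}$. (V9) $\mathrm{rank}(\varphi_{n+1,n}^{k,j}(1))=\mu_{k,j}(n+1)r_j(n)$. (V10) Identify $X_j^{s_j(n+1)}=(X_j^{s_j(n)})^{d_j(n+1)}$ with coordinate projections $P_{n,j,i}$, $1\le i\le d_j(n+1)$; with $t=[\mu_{j,j}(n+1)-d_j(n+1)]r_j(n)$ (possibly $0$) there is a unital homomorphism $\eta\colon C(X_j^{s_j(n)},M_{r_j(n)})\to C(X_j^{s_j(n+1)},M_t)$ such that $\varphi_{n+1,n}^{j,j}(f)=\mathrm{diag}(f\circ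 P_{n,j,1},\dots,f\circ P_{n,j,d_j(n+1)},\eta(f),0)$. Diagonal: a unital homomorphism $\bigoplus_j C(Z_j,M_{k_j})\to C(Y,M_l)$ is diagonal if it is unitarily equivalent to $(f_j)_j\mapsto\mathrm{diag}(f_1\circ h_{1,1},\dots,f_1\circ h_{1,t_1},\dots,f_m\circ h_{m,1},\dots,f_m\circ h_{m,t_m})$ for continuous maps $h_{j,i}\colon Y\to Z_j$; $\varphi_{n+1,n}$ is diagonal if its composition with projection to each summand of $A_{n+1}$ is. The map $\gamma$: under hypotheses (1)--(5), $r_1(n)=r_2(n)=r(n)$ and, since the spaces are contractible, $K_0(A_n)\cong\mathbb{Z}\oplus\mathbb{Z}$ via the ranks in the two summands. There is a unique homomorphism $\gamma\colon K_0(A)\to\mathbb{Q}\oplus\mathbb{Q}$ with $$\gamma\bigl((\varphi_{\infty,n})_*(m_1,m_2)\bigr)=\left(\frac{m_1+m_2}{2r(n)},\ \frac{m_1-m_2}{2r'(n)}\right)$$ for all $n\ge0$ and $m_1,m_2\in\mathbb{Z}$. The scale on $K_0(A)$ is given by the order unit $[1_A]$. *)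

(* Defs.v *)
From HB Require Import structures.
From mathcomp Require Import all_boot all_order all_algebra.
From mathcomp Require Import ssrAC generic_quotient complex.
From mathcomp Require Import all_classical all_reals all_analysis.

Set Implicit Arguments.
Unset Strict Implicit.
Unset Printing Implicit Defensive.

Import Order.TTheory GRing.Theory Num.Theory.
Import numFieldNormedType.Exports.

Local Open Scope classical_set_scope.
Local Open Scope ring_scope.
Local Open Scope quotient_scope.

Definition Cplx (R : realType) : numClosedFieldType := R[i].

(* A unital algebra over [C] is given by its scalars, i.e., by a unital ring
   morphism [k |-> scal k] from [C] to the centre.  MathComp's [algType] is not
   used here because it excludes the zero algebra. *)
HB.mixin Record isStarAlgebra (C : numClosedFieldType) A of GRing.PzRing A := {
  scal : C -> A;
  scal1 : scal 1 = 1;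
  scalD : {morph scal : k l / k + l};
  scalM : {morph scal : k l / k * l};
  scalC : forall (k : C) (a : A), scal k * a = a * scal k;
  star : A -> A;
  starK : involutive star;
  starD : {morph star : a b / a + b};
  starM : forall a b : A, star (a * b) = star b * star a;
  star_scal : forall k : C, star (scal k) = scal k^*
}.

#[short(type="starAlgType")]
HB.structure Definition StarAlgebra (C : numClosedFieldType) :=
  {A of GRing.PzRing A & isStarAlgebra C A}.

Arguments scal {C A} : rename.
Arguments star {C A} : rename.

Record starHom (C : numClosedFieldType) (A B : starAlgType C) := StarHom {
  starHom_fun :> {rmorphism A -> B};
  starHom_scal : forall k : C, starHom_fun (scal k) = scal k;
  starHom_star : forall a : A, starHom_fun (star a) = star (starHom_fun a)
}.

(* MathComp-Analysis has no normed ring; its normed modules cannot be joined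
   with rings, hence this explicit record. *)
Record cstarAlg (R : realType) := CstarAlg {
  cstar_car :> starAlgType (Cplx R);
  cnorm : cstar_car -> R;
  cnorm_eq0 : forall a, cnorm a = 0 -> a = 0;
  cnorm_triangle : forall a b, cnorm (a + b) <= cnorm a + cnorm b;
  cnorm_scal : forall (k : R[i]) a,
    cnorm (scal (k : Cplx R) * a) = Normc.normc k * cnorm a;
  cnorm_mul : forall a b, cnorm (a * b) <= cnorm a * cnorm b;
  cnorm_star : forall a, cnorm (star a * a) = cnorm a ^+ 2;
  cnorm_complete : forall u : nat -> cstar_car,
    (forall e : R, 0 < e -> exists N : nat, forall m n : nat,
        (N <= m)%N -> (N <= n)%N -> cnorm (u m - u n) < e) ->
    exists l, cnorm (u n - l) @[n --> \oo] --> (0 : R)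
}.
Arguments cnorm {R c}.

Section Groth.
Variable V : nmodType.

Definition groth_rel : rel (V * V) := fun x y =>
  `[< exists s, x.1 + y.2 + s = y.1 + x.2 + s >].

Lemma groth_rel_refl : reflexive groth_rel.
Proof. by move=> x; apply/asboolP; exists 0. Qed.

Lemma groth_rel_sym : symmetric groth_rel.
Proof.
by move=> x y; apply/idP/idP => /asboolP[s e]; apply/asboolP; exists s;
  rewrite e.
Qed.

Lemma groth_rel_trans : transitive groth_rel.
Proof.
move=> y x z /asboolP[s e] /asboolP[t f]; apply/asboolP.
exists (y.2 + s + (y.1 + t)).
rewrite (AC (2*(2*2)) ((1*3*4)*(5*2*6)))/= e f.
by rewrite (AC (3*3) (4*2*(5*3*(1*6)))).
Qed.

Definition groth_equiv :=
  EquivRel groth_rel groth_rel_refl groth_rel_sym groth_rel_trans.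

Definition groth := {eq_quot groth_equiv}.
HB.instance Definition _ := EqQuotient.on groth.
HB.instance Definition _ := Choice.on groth.

Definition groth_class (a b : V) : groth := \pi_groth (a, b).

Lemma groth_classP a b c d :
  groth_class a b = groth_class c d <-> exists s, a + d + s = c + b + s.
Proof.
rewrite /groth_class; split; last by move=> h; apply/eqmodP/asboolP.
by move=> /eqmodP/asboolP.
Qed.

Lemma groth_ind (P : groth -> Prop) :
  (forall a b, P (groth_class a b)) -> forall x, P x.
Proof. by move=> h x; rewrite -[x]reprK; case: (repr x) => a b; exact: h. Qed.

Definition groth_add (x y : groth) : groth :=
  groth_class ((repr x).1 + (repr y).1) ((repr x).2 + (repr y).2).

Definition groth_opp (x : groth) : groth :=
  groth_class (repr x).2 (repr x).1.

Lemma repr_groth_class a b :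
  exists s, (repr (groth_class a b)).1 + b + s = a + (repr (groth_class a b)).2 + s.
Proof.
by apply/groth_classP; rewrite {1}/groth_class -surjective_pairing reprK.
Qed.

Lemma groth_addE a b c d :
  groth_add (groth_class a b) (groth_class c d) = groth_class (a + c) (b + d).
Proof.
apply/groth_classP; have [s e] := repr_groth_class a b.
have [t f] := repr_groth_class c d; exists (s + t).
rewrite (AC (2*2*2) ((1*3*5)*(2*4*6)))/= e f.
by rewrite (AC (3*3) (1*4*(2*5)*(3*6))).
Qed.

Lemma groth_oppE a b : groth_opp (groth_class a b) = groth_class b a.
Proof.
apply/groth_classP; have [s e] := repr_groth_class a b; exists s.
by rewrite (addrC _ a) -e (addrC b).
Qed.

Fact groth_addA : associative groth_add.
Proof.
elim/groth_ind=> a b; elim/groth_ind=> c d; elim/groth_ind=> e f.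
by rewrite !groth_addE !addrA.
Qed.

Fact groth_addC : commutative groth_add.
Proof.
elim/groth_ind=> a b; elim/groth_ind=> c d.
by rewrite !groth_addE (addrC a) (addrC b).
Qed.

Fact groth_add0 : left_id (groth_class 0 0) groth_add.
Proof. by elim/groth_ind=> a b; rewrite !groth_addE !add0r. Qed.

Fact groth_addN : left_inverse (groth_class 0 0) groth_opp groth_add.
Proof.
elim/groth_ind=> a b; rewrite groth_oppE groth_addE; apply/groth_classP.
by exists 0; rewrite !addr0 add0r addrC.
Qed.

HB.instance Definition _ :=
  GRing.isZmodule.Build groth groth_addA groth_addC groth_add0 groth_addN.

End Groth.

Section MurrayVonNeumann.
Variables (C : numClosedFieldType) (A : starAlgType C).

Definition adjmx m n (M : 'M[A]_(m, n)) : 'M[A]_(n, m) := (map_mx star M)^T.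

Definition projmx n (p : 'M[A]_n) : Prop := adjmx p = p /\ p *m p = p.

Record matproj := MatProj {
  mpsize : nat;
  mpval :> 'M[A]_mpsize;
  mpvalP : projmx mpval
}.

HB.instance Definition _ := gen_eqMixin matproj.
HB.instance Definition _ := gen_choiceMixin matproj.

Definition mvn_equivalent (p q : matproj) : Prop :=
  exists v : 'M[A]_(mpsize q, mpsize p),
    adjmx v *m v = p /\ v *m adjmx v = q.

Lemma star0 : star 0 = 0 :> A.
Proof. by apply: (addIr (star 0)); rewrite -starD !add0r. Qed.

Lemma star1 : star 1 = 1 :> A.
Proof. by rewrite -[LHS]mul1r -{1}(starK 1) -starM mul1r starK. Qed.

Lemma star_sum (I : Type) (s : seq I) (P : pred I) (F : I -> A) :
  star (\sum_(i <- s | P i) F i) = \sum_(i <- s | P i) star (F i).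
Proof. by apply: (big_morph star starD star0). Qed.

Lemma adjmxK m n (M : 'M[A]_(m, n)) : adjmx (adjmx M) = M.
Proof. by apply/matrixP => i j; rewrite !mxE starK. Qed.

Lemma adjmxM m n p (M : 'M[A]_(m, n)) (N : 'M[A]_(n, p)) :
  adjmx (M *m N) = adjmx N *m adjmx M.
Proof.
apply/matrixP => i j; rewrite !mxE star_sum; apply: eq_bigr => k _.
by rewrite !mxE starM.
Qed.

Lemma adjmx0 m n : adjmx (0 : 'M[A]_(m, n)) = 0.
Proof. by apply/matrixP => i j; rewrite !mxE star0. Qed.

Lemma adjmx1 n : adjmx (1%:M : 'M[A]_n) = 1%:M.
Proof.
apply/matrixP => i j; rewrite !mxE eq_sym.
by case: eqP => _ /=; rewrite ?star1 ?star0.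
Qed.

Lemma adjmx_block m1 m2 n1 n2 (a : 'M[A]_(m1, n1)) (b : 'M[A]_(m1, n2))
    (c : 'M[A]_(m2, n1)) (d : 'M[A]_(m2, n2)) :
  adjmx (block_mx a b c d) = block_mx (adjmx a) (adjmx c) (adjmx b) (adjmx d).
Proof. by rewrite /adjmx map_block_mx tr_block_mx. Qed.

Fact mp0_subproof : projmx (0 : 'M[A]_0).
Proof. by split; rewrite ?adjmx0 ?mul0mx. Qed.
Definition mp0 : matproj := MatProj mp0_subproof.

Fact mp1_subproof : projmx (1%:M : 'M[A]_1).
Proof. by split; rewrite ?adjmx1 ?mul1mx. Qed.
Definition mp1 : matproj := MatProj mp1_subproof.

Fact mpsum_subproof (p q : matproj) :
  projmx (block_mx (mpval p) 0 0 (mpval q)).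
Proof.
have [[p1 p2] [q1 q2]] := (mpvalP p, mpvalP q); split.
  by rewrite adjmx_block p1 q1 !adjmx0.
by rewrite mulmx_block p2 q2 !mulmx0 !mul0mx !addr0 add0r.
Qed.
Definition mpsum (p q : matproj) : matproj := MatProj (mpsum_subproof p q).

Definition mvn_rel : rel matproj := fun p q => `[< mvn_equivalent p q >].

Lemma mvn_refl : reflexive mvn_rel.
Proof.
move=> p; apply/asboolP; exists (mpval p).
by have [p1 p2] := mpvalP p; rewrite p1.
Qed.

Lemma mvn_sym : symmetric mvn_rel.
Proof.
suff h p q : mvn_rel p q -> mvn_rel q p by move=> p q; apply/idP/idP; exact: h.
by move=> /asboolP[v [v1 v2]]; apply/asboolP; exists (adjmx v); rewrite adjmxK.
Qed.

Lemma mvn_trans : transitive mvn_rel.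
Proof.
move=> q p r /asboolP[v [v1 v2]] /asboolP[w [w1 w2]]; apply/asboolP.
have [p1 p2] := mpvalP p; have [r1 r2] := mpvalP r.
exists (w *m v); rewrite adjmxM; split.
  by rewrite mulmxA -(mulmxA (adjmx v)) w1 -v2 mulmxA v1 -mulmxA v1 p2.
by rewrite mulmxA -(mulmxA w) v2 -w1 mulmxA w2 -mulmxA w2 r2.
Qed.

Definition mvn_equiv := EquivRel mvn_rel mvn_refl mvn_sym mvn_trans.

Definition mvn := {eq_quot mvn_equiv}.
HB.instance Definition _ := EqQuotient.on mvn.
HB.instance Definition _ := Choice.on mvn.

Definition mvn_class (p : matproj) : mvn := \pi_mvn p.

Lemma mvn_classP p q : mvn_class p = mvn_class q <-> mvn_equivalent p q.
Proof.
rewrite /mvn_class; split; last by move=> h; apply/eqmodP/asboolP.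
by move=> /eqmodP/asboolP.
Qed.

Lemma mvn_ind (P : mvn -> Prop) :
  (forall p, P (mvn_class p)) -> forall x, P x.
Proof. by move=> h x; rewrite -[x]reprK; exact: h. Qed.

Definition mvn_add (x y : mvn) : mvn := mvn_class (mpsum (repr x) (repr y)).

Lemma mvn_sum p p' q q' : mvn_equivalent p p' -> mvn_equivalent q q' ->
  mvn_equivalent (mpsum p q) (mpsum p' q').
Proof.
move=> [v [v1 v2]] [w [w1 w2]]; exists (block_mx v 0 0 w).
rewrite adjmx_block !mulmx_block !adjmx0 !mul0mx !mulmx0 !addr0 !add0r.
by rewrite v1 v2 w1 w2.
Qed.

Lemma mvn_isometry (p q : matproj) (w : 'M[A]_(mpsize q, mpsize p)) :
  adjmx w *m w = 1%:M -> w *m p *m adjmx w = q -> mvn_equivalent p q.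
Proof.
have [p1 p2] := mpvalP p => w1 e; exists (w *m p); rewrite adjmxM p1.
by rewrite mulmxA -(mulmxA _ _ w) w1 mulmx1 mulmxA -(mulmxA w) p2.
Qed.

Lemma mvn_addE p q :
  mvn_add (mvn_class p) (mvn_class q) = mvn_class (mpsum p q).
Proof.
by apply/mvn_classP/mvn_sum; apply/mvn_classP; rewrite /mvn_class reprK.
Qed.

Lemma mvn_cast (p q : matproj) (e : mpsize p = mpsize q) :
  castmx (e, e) p = q -> mvn_equivalent p q.
Proof.
case: p q e => n p [p1 p2] [n' q qP] /= e; case: n' / e q qP => q qP.
by rewrite castmx_id => e; exists p => /=; rewrite p1 p2 e.
Qed.

Fact mvn_addA : associative mvn_add.
Proof.
elim/mvn_ind=> p; elim/mvn_ind=> q; elim/mvn_ind=> r.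
rewrite !mvn_addE; apply/mvn_classP.
apply: (@mvn_cast (mpsum p (mpsum q r)) (mpsum (mpsum p q) r) (addnA _ _ _)).
have := @block_mxA _ _ _ _ _ _ _ (mpval p) 0 0 0 (mpval q) 0 0 0 (mpval r).
by rewrite !row_mx0 !col_mx0 /= => ->; rewrite castmx_comp castmx_id.
Qed.

Fact mvn_addC : commutative mvn_add.
Proof.
elim/mvn_ind=> p; elim/mvn_ind=> q; rewrite !mvn_addE; apply/mvn_classP.
apply: (@mvn_isometry (mpsum p q) (mpsum q p) (block_mx 0 1%:M 1%:M 0 :
  'M[A]_(mpsize q + mpsize p, mpsize p + mpsize q))).
  rewrite adjmx_block !adjmx0 !adjmx1 mulmx_block !mulmx1 !mulmx0.
  by rewrite !addr0 !add0r -scalar_mx_block.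
rewrite /= adjmx_block !adjmx0 !adjmx1 !mulmx_block.
by rewrite !mulmx1 !mul1mx !mulmx0 !mul0mx !addr0 !add0r.
Qed.

Fact mvn_add0 : left_id (mvn_class mp0) mvn_add.
Proof.
elim/mvn_ind=> p; rewrite mvn_addE; apply/mvn_classP.
apply: (@mvn_cast (mpsum mp0 p) p erefl); rewrite castmx_id /=.
apply/matrixP => i j; rewrite -[RHS](block_mxEdr (0 : 'M[A]_0) 0 0).
by congr (block_mx _ _ _ _ _ _); apply/val_inj.
Qed.

HB.instance Definition _ :=
  GRing.isNmodule.Build mvn mvn_addA mvn_addC mvn_add0.

Definition K0 : zmodType := groth mvn.

Definition K0_class (p q : matproj) : K0 :=
  groth_class (mvn_class p) (mvn_class q).

Lemma K0_ind (P : K0 -> Prop) :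
  (forall p q, P (K0_class p q)) -> forall x, P x.
Proof.
move=> h; elim/groth_ind; elim/mvn_ind=> p; elim/mvn_ind=> q; exact: h.
Qed.

End MurrayVonNeumann.

Arguments mp1 {C A}.

Section K0Functor.
Variables (C : numClosedFieldType) (A B : starAlgType C) (f : starHom A B).

Lemma adjmx_map m n (M : 'M[A]_(m, n)) :
  adjmx (map_mx f M) = map_mx f (adjmx M).
Proof. by apply/matrixP => i j; rewrite !mxE starHom_star. Qed.

Fact mpmap_subproof (p : matproj A) : projmx (map_mx f p).
Proof.
have [p1 p2] := mpvalP p; split; first by rewrite adjmx_map p1.
by rewrite -map_mxM p2.
Qed.
Definition mpmap (p : matproj A) : matproj B := MatProj (mpmap_subproof p).

Lemma mpmap_mvn p q : mvn_equivalent p q -> mvn_equivalent (mpmap p) (mpmap q).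
Proof.
move=> [v [v1 v2]]; exists (map_mx f v : 'M[B]_(mpsize q, mpsize p)).
by rewrite adjmx_map -!map_mxM v1 v2.
Qed.

Definition mvn_map (x : mvn A) : mvn B := mvn_class (mpmap (repr x)).

Lemma mvn_mapE p : mvn_map (mvn_class p) = mvn_class (mpmap p).
Proof.
by apply/mvn_classP/mpmap_mvn/mvn_classP; rewrite /mvn_class reprK.
Qed.

Lemma mvn_mapD : {morph mvn_map : x y / x + y}.
Proof.
elim/mvn_ind=> p; elim/mvn_ind=> q.
rewrite [X in mvn_map X]mvn_addE !mvn_mapE [RHS]mvn_addE; apply/mvn_classP.
apply: (@mvn_cast _ _ (mpmap (mpsum p q)) (mpsum (mpmap p) (mpmap q)) erefl).
by rewrite castmx_id /= map_block_mx !map_mx0.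
Qed.

Definition K0_map (x : K0 A) : K0 B :=
  groth_class (mvn_map (repr (x : groth (mvn A))).1)
              (mvn_map (repr (x : groth (mvn A))).2).

Lemma K0_mapE p q :
  K0_map (K0_class p q) = K0_class (mpmap p) (mpmap q).
Proof.
rewrite /K0_map /K0_class; apply/groth_classP.
have [s e] := repr_groth_class (mvn_class p) (mvn_class q).
exists (mvn_map s); rewrite -!mvn_mapE -!mvn_mapD e.
by [].
Qed.

End K0Functor.

Record scaledGroup := ScaledGroup {
  sg_car :> zmodType;
  sg_pos : set sg_car;
  sg_unit : sg_car
}.

Definition scaled_group_iso (G H : scaledGroup) (f : {additive G -> H}) : Prop :=
  [/\ bijective f,
      (forall x, sg_pos x <-> sg_pos (f x)) &
      f (sg_unit G) = sg_unit H].

Definition K0_scaled (C : numClosedFieldType) (A : starAlgType C) : scaledGroup :=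
  @ScaledGroup (K0 A) [set x | exists p, x = K0_class p (mp0 A)]
    (K0_class mp1 (mp0 A)).

Definition QQ_scaled (R : realType) (lambda : R) : scaledGroup :=
  @ScaledGroup (rat * rat)%type
    [set z | z = (0, 0) \/ ratr z.1 > lambda * `|ratr z.2|] (1, 0).

Section MatrixFunctions.
Variables (R : realType) (Y : topologicalType) (k : nat).
Let C := Cplx R.

Record cmx := Cmx {
  cmx_fun :> Y -> 'M[C]_k;
  cmx_continuous : continuous cmx_fun
}.

HB.instance Definition _ := gen_eqMixin cmx.
HB.instance Definition _ := gen_choiceMixin cmx.

Lemma cmxP (f g : cmx) : f =1 g -> f = g.
Proof.
case: f g => f fc [g gc] /= /funext e; case: g / e gc => gc.
by congr Cmx; exact: Prop_irrelevance.
Qed.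

Lemma continuous_entry (f : Y -> 'M[C]_k) :
  (forall i j, continuous (fun y => f y i j)) -> continuous f.
Proof.
move=> fc y A [P nP PA].
have : \forall z \near y, forall i j, P i j (f z i j).
  apply: (@filter_forall Y 'I_k (fun i z => forall j, P i j (f z i j))) => i.
  apply: (@filter_forall Y 'I_k (fun j z => P i j (f z i j))) => j.
  exact: (fc i j y _ (nP i j)).
by apply: filterS => z hz; exact: PA.
Qed.

Lemma cmx_entry (f : cmx) i j : continuous (fun y => f y i j).
Proof.
move=> y; apply: (@continuous_comp _ _ _ (cmx_fun f) (fun M => M i j)).
  exact: cmx_continuous.
exact: coord_continuous.
Qed.

Definition cmx_cst (M : 'M[C]_k) := Cmx (@cst_continuous Y _ M).

Definition cmx_opp (f : cmx) :=
  Cmx (fun y => continuousN (@cmx_continuous f y)).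

Definition cmx_add (f g : cmx) :=
  Cmx (fun y => continuousD (@cmx_continuous f y) (@cmx_continuous g y)).

Fact cmx_mul_subproof (f g : cmx) : continuous (fun y => f y *m g y).
Proof.
apply: continuous_entry => i j.
suff h s : continuous (fun y => \sum_(l <- s) f y i l * g y l j).
  rewrite (_ : (fun y => _) = fun y => \sum_l f y i l * g y l j); first exact: h.
  by apply/funext => y; rewrite mxE.
elim: s => [|l s IHs].
  rewrite (_ : (fun y => _) = cst 0); first exact: cst_continuous.
  by apply/funext => y; rewrite big_nil.
rewrite (_ : (fun y => _) = (fun y => f y i l * g y l j) \+
  (fun y => \sum_(l <- s) f y i l * g y l j)).
  move=> y; apply: continuousD (IHs y).
  by apply: continuousM; exact: cmx_entry.
by apply/funext => y; rewrite big_cons.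
Qed.
Definition cmx_mul (f g : cmx) := Cmx (@cmx_mul_subproof f g).

Fact cmx_star_subproof (f : cmx) :
  continuous (fun y => (map_mx Num.conj (f y))^T).
Proof.
apply: continuous_entry => i j.
rewrite (_ : (fun y => _) = fun y => (f y j i)^*); last first.
  by apply/funext => y; rewrite !mxE.
move=> y; apply/cvgrPdist_lt => e e0.
have /cvgrPdist_lt/(_ e e0) := @cmx_entry f j i y.
by apply: filterS => z; rewrite -rmorphB norm_conjC.
Qed.
Definition cmx_star (f : cmx) := Cmx (@cmx_star_subproof f).

Fact cmx_addA : associative cmx_add.
Proof. by move=> f g h; apply: cmxP => y /=; rewrite addrA. Qed.
Fact cmx_addC : commutative cmx_add.
Proof. by move=> f g; apply: cmxP => y /=; rewrite addrC. Qed.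
Fact cmx_add0 : left_id (cmx_cst 0) cmx_add.
Proof. by move=> f; apply: cmxP => y /=; rewrite add0r. Qed.
Fact cmx_addN : left_inverse (cmx_cst 0) cmx_opp cmx_add.
Proof. by move=> f; apply: cmxP => y /=; rewrite addNr. Qed.
HB.instance Definition _ :=
  GRing.isZmodule.Build cmx cmx_addA cmx_addC cmx_add0 cmx_addN.

Fact cmx_mulA : associative cmx_mul.
Proof. by move=> f g h; apply: cmxP => y /=; rewrite mulmxA. Qed.
Fact cmx_mul1 : left_id (cmx_cst 1%:M) cmx_mul.
Proof. by move=> f; apply: cmxP => y /=; rewrite mul1mx. Qed.
Fact cmx_mulr1 : right_id (cmx_cst 1%:M) cmx_mul.
Proof. by move=> f; apply: cmxP => y /=; rewrite mulmx1. Qed.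
Fact cmx_mulDl : left_distributive cmx_mul +%R.
Proof. by move=> f g h; apply: cmxP => y /=; rewrite mulmxDl. Qed.
Fact cmx_mulDr : right_distributive cmx_mul +%R.
Proof. by move=> f g h; apply: cmxP => y /=; rewrite mulmxDr. Qed.
HB.instance Definition _ := GRing.Zmodule_isPzRing.Build cmx
  cmx_mulA cmx_mul1 cmx_mulr1 cmx_mulDl cmx_mulDr.

Definition cmx_scal (c : C) : cmx := cmx_cst c%:M.

Fact cmx_scal1 : cmx_scal 1 = 1.
Proof. by []. Qed.
Fact cmx_scalD : {morph cmx_scal : a b / a + b}.
Proof. by move=> a b; apply: cmxP => y /=; rewrite raddfD. Qed.
Fact cmx_scalM : {morph cmx_scal : a b / a * b}.
Proof. by move=> a b; apply: cmxP => y /=; rewrite scalar_mxM. Qed.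
Fact cmx_scalC c (f : cmx) : cmx_scal c * f = f * cmx_scal c.
Proof. by apply: cmxP => y /=; rewrite /= scalar_mxC. Qed.
Fact cmx_starK : involutive cmx_star.
Proof. by move=> f; apply: cmxP => y; apply/matrixP => i j; rewrite !mxE conjCK. Qed.
Fact cmx_starD : {morph cmx_star : f g / f + g}.
Proof.
by move=> f g; apply: cmxP => y; apply/matrixP => i j; rewrite !mxE rmorphD.
Qed.
Fact cmx_starM (f g : cmx) : cmx_star (f * g) = cmx_star g * cmx_star f.
Proof. by apply: cmxP => y /=; rewrite map_mxM trmx_mul. Qed.
Fact cmx_star_scal c : cmx_star (cmx_scal c) = cmx_scal c^*.
Proof. by apply: cmxP => y /=; rewrite map_scalar_mx tr_scalar_mx. Qed.
HB.instance Definition _ := isStarAlgebra.Build C cmx cmx_scal1 cmx_scalD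
  cmx_scalM cmx_scalC cmx_starK cmx_starD cmx_starM cmx_star_scal.

Definition vnorm (v : 'cV[C]_k) : R := Num.sqrt (\sum_i Normc.normc (v i 0) ^+ 2).

(* The C*-norm of [M_k]: the operator norm for the Euclidean norm of [C^k] *)
Definition opnorm (M : 'M[C]_k) : R :=
  sup [set vnorm (M *m v) | v in [set v | vnorm v <= 1]].

Definition cmx_norm (f : cmx) : R := sup (range (fun y => opnorm (f y))).

End MatrixFunctions.

Section DirectSum.
Variables (C : numClosedFieldType) (I : finType) (B : I -> starAlgType C).

Definition dsum := forall i, B i.
Implicit Types a b c : dsum.

HB.instance Definition _ := gen_eqMixin dsum.
HB.instance Definition _ := gen_choiceMixin dsum.

Lemma dsumP a b : (forall i, a i = b i) -> a = b.
Proof. exact: functional_extensionality_dep. Qed.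

Definition dsum0 : dsum := fun i => 0.
Definition dsum1 : dsum := fun i => 1.
Definition dsum_opp a : dsum := fun i => - a i.
Definition dsum_add a b : dsum := fun i => a i + b i.
Definition dsum_mul a b : dsum := fun i => a i * b i.
Definition dsum_star a : dsum := fun i => star (a i).
Definition dsum_scal (k : C) : dsum := fun i => scal k.

Fact dsum_addA : associative dsum_add.
Proof. by move=> a b c; apply: dsumP => i; exact: addrA. Qed.
Fact dsum_addC : commutative dsum_add.
Proof. by move=> a b; apply: dsumP => i; exact: addrC. Qed.
Fact dsum_add0 : left_id dsum0 dsum_add.
Proof. by move=> a; apply: dsumP => i; exact: add0r. Qed.
Fact dsum_addN : left_inverse dsum0 dsum_opp dsum_add.
Proof. by move=> a; apply: dsumP => i; exact: addNr. Qed.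
HB.instance Definition _ :=
  GRing.isZmodule.Build dsum dsum_addA dsum_addC dsum_add0 dsum_addN.

Fact dsum_mulA : associative dsum_mul.
Proof. by move=> a b c; apply: dsumP => i; exact: mulrA. Qed.
Fact dsum_mul1 : left_id dsum1 dsum_mul.
Proof. by move=> a; apply: dsumP => i; exact: mul1r. Qed.
Fact dsum_mulr1 : right_id dsum1 dsum_mul.
Proof. by move=> a; apply: dsumP => i; exact: mulr1. Qed.
Fact dsum_mulDl : left_distributive dsum_mul +%R.
Proof. by move=> a b c; apply: dsumP => i; exact: mulrDl. Qed.
Fact dsum_mulDr : right_distributive dsum_mul +%R.
Proof. by move=> a b c; apply: dsumP => i; exact: mulrDr. Qed.
HB.instance Definition _ := GRing.Zmodule_isPzRing.Build dsum
  dsum_mulA dsum_mul1 dsum_mulr1 dsum_mulDl dsum_mulDr.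

Fact dsum_scal1 : dsum_scal 1 = 1.
Proof. by apply: dsumP => i; exact: scal1. Qed.
Fact dsum_scalD : {morph dsum_scal : k l / k + l}.
Proof. by move=> k l; apply: dsumP => i; exact: scalD. Qed.
Fact dsum_scalM : {morph dsum_scal : k l / k * l}.
Proof. by move=> k l; apply: dsumP => i; exact: scalM. Qed.
Fact dsum_scalC k a : dsum_scal k * a = a * dsum_scal k.
Proof. by apply: dsumP => i; exact: scalC. Qed.
Fact dsum_starK : involutive dsum_star.
Proof. by move=> a; apply: dsumP => i; exact: starK. Qed.
Fact dsum_starD : {morph dsum_star : a b / a + b}.
Proof. by move=> a b; apply: dsumP => i; exact: starD. Qed.
Fact dsum_starM a b : dsum_star (a * b) = dsum_star b * dsum_star a.
Proof. by apply: dsumP => i; exact: starM. Qed.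
Fact dsum_star_scal k : dsum_star (dsum_scal k) = dsum_scal k^*.
Proof. by apply: dsumP => i; exact: star_scal. Qed.
HB.instance Definition _ := isStarAlgebra.Build C dsum dsum_scal1 dsum_scalD
  dsum_scalM dsum_scalC dsum_starK dsum_starD dsum_starM dsum_star_scal.

Definition dsum_in i (x : B i) : dsum := dfwith (0 : dsum) i x.

End DirectSum.

Fixpoint connecting (C : numClosedFieldType) (B : nat -> starAlgType C)
    (phi : forall n, starHom (B n) (B n.+1)) n k : B n -> B (k + n)%N :=
  match k return B n -> B (k + n)%N with
  | 0 => id
  | k'.+1 => fun b => phi (k' + n)%N (connecting phi k' b)
  end.

(* [A] is the Hausdorff completion of the algebraic direct limit for the
   seminorm [b |-> lim_k nrm (connecting phi k b)] on stage [n]. *)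
Record is_direct_limit (R : realType) (B : nat -> starAlgType (Cplx R))
    (nrm : forall n, B n -> R) (phi : forall n, starHom (B n) (B n.+1))
    (A : cstarAlg R) (phioo : forall n, starHom (B n) A) : Prop := IsDirectLimit {
  dl_compat : forall n (b : B n), @phioo n.+1 (@phi n b) = @phioo n b;
  dl_norm : forall n (b : B n),
    @nrm (k + n)%N (connecting phi k b) @[k --> \oo] --> cnorm (@phioo n b);
  dl_dense : forall (a : A) (e : R), 0 < e ->
    exists n (b : B n), cnorm (a - @phioo n b) < e
}.

Definition contractible (R : realType) (T : topologicalType) : Prop :=
  exists (x0 : T) (H : R * T -> T),
    [/\ {within [set p | 0 <= p.1 <= 1], continuous H},
        forall x, H (0, x) = x & forall x, H (1, x) = x0].

(* Sequences indexed by [n >= 1] are functions on [nat] whose value at [0] is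
   irrelevant.  [mu k j n] is the multiplicity from summand [j] to [k]. *)
Record sys_data (R : realType) (m : nat) := SysData {
  sp : 'I_m -> metricType R;
  dd : 'I_m -> nat -> nat;
  mu : 'I_m -> 'I_m -> nat -> nat;
  rr : 'I_m -> nat -> nat;
  sys_m_gt0 : (0 < m)%N;
  sp_compact : forall j, compact [set: sp j];
  dd_gt0 : forall j n, (0 < n)%N -> (0 < dd j n)%N;
  dd_le_mu : forall j n, (0 < n)%N -> (dd j n <= mu j j n)%N;
  rr0_gt0 : forall j, (0 < rr j 0)%N;
  rrS : forall k n, rr k n.+1 = (\sum_j mu k j n.+1 * rr j n)%N;
  rr_oo : forall j, rr j n @[n --> \oo] --> \oo
}.

Section Stages.
Variables (R : realType) (m : nat) (S : sys_data R m).

Definition ss j n : nat := \prod_(1 <= k < n.+1) dd S j k.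

Definition space j n : topologicalType :=
  prod_topology (fun _ : 'I_(ss j n) => sp S j).

Definition stage n : starAlgType (Cplx R) :=
  dsum (fun j => cmx R (space j n) (rr S j n)).

Definition stage_norm n (a : stage n) : R :=
  \big[Num.max/0]_j cmx_norm (a j).

Fact coord_subproof j n (i : 'I_(dd S j n.+1)) (a : 'I_(ss j n)) :
  (i * ss j n + a < ss j n.+1)%N.
Proof.
have -> : ss j n.+1 = (dd S j n.+1 * ss j n)%N by rewrite /ss big_nat_recr //= mulnC.
apply: (@leq_trans (i.+1 * ss j n)); last by rewrite leq_mul2r ltn_ord orbT.
by rewrite mulSn addnC -addSn leq_add2r ltn_ord.
Qed.

(* The projection of [X^(s(n+1)) = (X^(s(n)))^(d(n+1))] to its [i]-th factor,
   i.e., to the [i]-th block of [s(n)] consecutive coordinates *)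
Definition proj_block j n (i : 'I_(dd S j n.+1)) (x : space j n.+1) : space j n :=
  fun a => x (Ordinal (coord_subproof i a)).

Definition component n n' (psi : stage n -> stage n') k j
    (f : cmx R (space j n) (rr S j n)) : cmx R (space k n') (rr S k n') :=
  psi (dsum_in f : stage n) k.

End Stages.

(* [diag (f_1 o h_(1,1), ..., f_1 o h_(1,t_1), ..., f_m o h_(m,t_m))] *)
Definition diag_blocks (R : realType) m (Y : topologicalType)
    (Z : 'I_m -> topologicalType) (k : 'I_m -> nat) (t : 'I_m -> nat)
    (h : forall j, 'I_(t j) -> Y -> Z j)
    (f : dsum (fun j => cmx R (Z j) (k j))) (y : Y) :
    'M[Cplx R]_(\sum_j \sum_(i < t j) k j) :=
  \mxdiag_j \mxdiag_(i < t j) f j (h j i y).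

Definition diagonal_to (R : realType) m (Y : topologicalType) (l : nat)
    (Z : 'I_m -> topologicalType) (k : 'I_m -> nat)
    (psi : dsum (fun j => cmx R (Z j) (k j)) -> cmx R Y l) : Prop :=
  exists (t : 'I_m -> nat) (h : forall j, 'I_(t j) -> Y -> Z j)
    (e : (\sum_j \sum_(i < t j) k j)%N = l) (w : cmx R Y l),
  [/\ forall j i, continuous (h j i),
      w * star w = 1, star w * w = 1 &
      forall f y, psi f y = w y *m castmx (e, e) (diag_blocks h f y) *m star w y].

Record system (R : realType) (m : nat) := System {
  sys_base :> sys_data R m;
  sys_map : forall n, starHom (stage sys_base n) (stage sys_base n.+1);
  sys_rank : forall n k j (y : space sys_base k n.+1),
    \rank (component (sys_map n) k (1 : cmx R (space sys_base j n) _) y) =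
      (mu sys_base k j n.+1 * rr sys_base j n)%N;
  sys_coord : forall n j,
    let r := rr sys_base j n in
    let d := dd sys_base j n.+1 in
    let t := ((mu sys_base j j n.+1 - d) * r)%N in
    exists (eta : starHom (cmx R (space sys_base j n) r)
                          (cmx R (space sys_base j n.+1) t))
      (z : nat) (e : ((\sum_(i < d) r + t) + z)%N = rr sys_base j n.+1),
    forall (f : cmx R (space sys_base j n) r) y,
      component (sys_map n) j f y =
      castmx (e, e) (block_mx
        (block_mx (\mxdiag_(i < d) f (proj_block i y)) 0 0 (eta f y)) 0
        0 (0 : 'M[Cplx R]_z))
}.

Definition sys_limit (R : realType) m (S : system R m) (A : cstarAlg R)
    (phioo : forall n, starHom (stage S n) A) : Prop :=
  is_direct_limit (@stage_norm _ _ S) (sys_map S) phioo.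

Definition sys_diagonal (R : realType) m (S : system R m) : Prop :=
  forall n k, diagonal_to (fun f : stage S n => sys_map S n f k).

(* A matrix over [A_n] evaluated at a point is a matrix of matrices, which is
   flattened before its rank is taken. *)
Definition mprank (R : realType) m (S : sys_data R m) n (p : matproj (stage S n))
    j (y : space S j n) : nat :=
  \rank (\mxblock_(a < mpsize p, b < mpsize p) (mpval p a b j y)).

(* [x] is the element of [K0 A_n] with rank [v j] in the [j]-th summand. *)
Definition K0_has_rank (R : realType) m (S : sys_data R m) n
    (x : K0 (stage S n)) (v : 'I_m -> int) : Prop :=
  exists p q : matproj (stage S n), x = K0_class p q /\
    forall j (y : space S j n), (mprank p y)%:Z - (mprank q y)%:Z = v j.

(* [gamma ((phi_(oo,n))_* (m1, m2)) =
     ((m1 + m2) / (2 r(n)), (m1 - m2) / (2 r'(n)))],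
   where [(m1, m2)] is the element of [K0 A_n] with these two ranks *)
Definition is_gamma (R : realType) (S : system R 2) (A : cstarAlg R)
    (phioo : forall n, starHom (stage S n) A) (r r' : nat -> nat)
    (gamma : K0 A -> rat * rat) : Prop :=
  forall n (x : K0 (stage S n)) (v : 'I_2 -> int), K0_has_rank x v ->
    gamma (K0_map (phioo n) x) =
      ((v ord0 + v ord_max)%:~R / (2 * r n)%:R,
       (v ord0 - v ord_max)%:~R / (2 * r' n)%:R).

(* Main.v *)
(* K_0 is computed stage by stage.  Every projection over the limit is close to
   a projection coming from some stage, because an approximate projection can be
   corrected with an inverse square root, and close projections are equivalent.
   Since the spaces are contractible, a projection over a stage is homotopic to
   a constant one and is determined up to equivalence by its two ranks.  If the
   images of two projections in the limit are equivalent, then approximating the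
   partial isometry at a late stage shows that their ranks agree there.  As the
   connecting maps are diagonal, they multiply the sum of the two ranks by [l]
   and the difference by [l - 2 c], so the normalised pair defining gamma does
   not depend on the stage and separates the classes.  The divisibility
   hypothesis gives surjectivity.  Finally a pair of ranks is nonnegative at
   stage [n] iff [x >= (r'(n)/r(n)) |y|], and [r'(n)/r(n)] decreases strictly to
   [lambda]. *)
Require Import Defs.
From HB Require Import structures.
From mathcomp Require Import all_boot all_order all_algebra.
From mathcomp Require Import complex.
From mathcomp Require Import all_classical all_reals all_analysis.
From mathcomp Require Import zify ring lra.

Set Implicit Arguments.
Unset Strict Implicit.
Unset Printing Implicit Defensive.

Import Order.TTheory GRing.Theory Num.Theory.
Import numFieldNormedType.Exports.

Local Open Scope classical_set_scope.
Local Open Scope ring_scope.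

(** * Matrices over a C*-algebra *)

(** Only a norm on the coefficient algebra is given, not the C*-norm of matrices over it. All
    estimates therefore use [mnorm], the sum of the norms of the entries, which is
    submultiplicative, complete and invariant under the adjoint. The identity of size [n] may have
    [mnorm] equal to [n], so bounds must avoid the norm of [1]: the inverse square root is sought in
    the form [1 + 2 z], and only [z] is estimated. It comes from a contraction, without any
    spectrum; the threshold [32^-1] makes the contraction work, and the other constants serve to get
    below this threshold. The way back from the limit to a stage is that the limit norm is the limit
    of the stage norms: a strict inequality over the limit holds at all late stages. An approximated
    partial isometry [u] is not repaired there. That [u^* u] is close to [p] already makes [p]
    factor through [q], which bounds one rank by the other, and [u u^*] gives the reverse bound. The
    pair defining gamma is first attached to Murray-von Neumann classes, where it is additive and
    injective; only then does it pass to the group. *)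

Lemma cvg0_le0 (R : realType) (a K : R) (v : nat -> R) :
  v n @[n --> \oo] --> (0 : R) -> (forall n, a <= K * v n) -> a <= 0.
Proof.
move=> v0 aK; rewrite -(mulr0 K).
by apply: ler_cvg_to (cvg_cst a) (cvgMl_tmp v0) _; exact: nearW.
Qed.

Section CstarNorm.
Variables (R : realType) (A : cstarAlg R).
Implicit Types a b : A.

Lemma cnorm0 : cnorm (0 : A) = 0.
Proof.
have := cnorm_scal 0 (0 : A).
by rewrite mulr0 => ->; rewrite Normc.normc0 mul0r.
Qed.

Lemma scal0 : scal (0 : Cplx R) = 0 :> A.
Proof. by apply: (addrI (scal (0 : Cplx R))); rewrite -scalD !addr0. Qed.

Lemma scalN1 a : scal (- 1 : Cplx R) * a = - a.
Proof.
apply/eqP; rewrite -addr_eq0 -{2}[a]mul1r -(@scal1 (Cplx R) A) -mulrDl -scalD.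
by rewrite addNr scal0 mul0r.
Qed.

Lemma cnormN a : cnorm (- a) = cnorm a.
Proof. by rewrite -scalN1 cnorm_scal normcN Normc.normc1 mul1r. Qed.

Lemma cnorm_ge0 a : 0 <= cnorm a.
Proof.
have := cnorm_triangle a (- a); rewrite subrr cnorm0 cnormN -mulr2n.
by rewrite pmulrn_lge0.
Qed.

Lemma cnormB a b : cnorm (a - b) = cnorm (b - a).
Proof. by rewrite -cnormN opprB. Qed.

(** The C*-identity gives [|b|^2 = |b^* b| <= |b^*| |b|]. Cancelling [|b|] yields one inequality,
    and exchanging [b] with its adjoint yields the other. *)
Lemma cnorm_starE a : cnorm (star a) = cnorm a.
Proof.
suff le b : cnorm b <= cnorm (star b).
  by apply/le_anti; rewrite -{2}(starK a) !le.
have [->|b0] := eqVneq (cnorm b) 0; first exact: cnorm_ge0.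
have b_gt0 : 0 < cnorm b by rewrite lt_def b0 cnorm_ge0.
by rewrite -(ler_pM2r b_gt0) -expr2 -cnorm_star cnorm_mul.
Qed.

Lemma ler_cnorm_sum I (s : seq I) (P : pred I) (F : I -> A) :
  cnorm (\sum_(i <- s | P i) F i) <= \sum_(i <- s | P i) cnorm (F i).
Proof.
elim/big_rec2: _ => [|i x y _ le]; first by rewrite cnorm0.
by rewrite (le_trans (cnorm_triangle _ _))// lerD2l.
Qed.

Definition mnorm m n (M : 'M[A]_(m, n)) : R := \sum_i \sum_j cnorm (M i j).

Lemma mnorm_ge0 m n (M : 'M[A]_(m, n)) : 0 <= mnorm M.
Proof. by do 2!apply: sumr_ge0 => ? _; exact: cnorm_ge0. Qed.

Lemma cnorm_le_mnorm m n (M : 'M[A]_(m, n)) i j : cnorm (M i j) <= mnorm M.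
Proof.
rewrite /mnorm (bigD1 i)//= (bigD1 j)//= -addrA lerDl addr_ge0//.
  by apply: sumr_ge0 => ? _; exact: cnorm_ge0.
by do 2!apply: sumr_ge0 => ? _; exact: cnorm_ge0.
Qed.

Lemma mnorm_le0 m n (M : 'M[A]_(m, n)) : mnorm M <= 0 -> M = 0.
Proof.
move=> M0; apply/matrixP => i j; rewrite mxE; apply: cnorm_eq0.
by apply/le_anti; rewrite cnorm_ge0 (le_trans (cnorm_le_mnorm _ _ _)).
Qed.

Lemma mnorm0 m n : mnorm (0 : 'M[A]_(m, n)) = 0.
Proof.
by rewrite /mnorm !big1// => i _; rewrite big1// => j _; rewrite mxE cnorm0.
Qed.

Lemma mnormN m n (M : 'M[A]_(m, n)) : mnorm (- M) = mnorm M.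
Proof. by do 2!apply: eq_bigr => ? _; rewrite mxE cnormN. Qed.

Lemma mnormB m n (M N : 'M[A]_(m, n)) : mnorm (M - N) = mnorm (N - M).
Proof. by rewrite -mnormN opprB. Qed.

Lemma mnormD m n (M N : 'M[A]_(m, n)) : mnorm (M + N) <= mnorm M + mnorm N.
Proof.
rewrite -big_split; apply: ler_sum => i _; rewrite -big_split /=.
by apply: ler_sum => j _; rewrite mxE cnorm_triangle.
Qed.

Lemma mnorm_dist m n (L M N : 'M[A]_(m, n)) :
  mnorm (M - N) <= mnorm (M - L) + mnorm (L - N).
Proof. by rewrite (le_trans _ (mnormD _ _))// subrKA. Qed.

Lemma mnormM m n p (M : 'M[A]_(m, n)) (N : 'M[A]_(n, p)) :
  mnorm (M *m N) <= mnorm M * mnorm N.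
Proof.
rewrite [leRHS]mulr_suml; apply: ler_sum => i _.
apply: (@le_trans _ _ (\sum_j \sum_k cnorm (M i k) * cnorm (N k j))).
  apply: ler_sum => j _; rewrite mxE (le_trans (ler_cnorm_sum _ _ _))//.
  by apply: ler_sum => k _; exact: cnorm_mul.
rewrite exchange_big mulr_suml; apply: ler_sum => k _.
rewrite -mulr_sumr ler_wpM2l ?cnorm_ge0//.
rewrite /mnorm (bigD1 k)//= lerDl.
by do 2!apply: sumr_ge0 => ? _; exact: cnorm_ge0.
Qed.

Lemma mnorm_adj m n (M : 'M[A]_(m, n)) : mnorm (adjmx M) = mnorm M.
Proof.
rewrite /mnorm exchange_big; do 2!apply: eq_bigr => ? _.
by rewrite !mxE cnorm_starE.
Qed.

Lemma adjmxD m n (M N : 'M[A]_(m, n)) : adjmx (M + N) = adjmx M + adjmx N.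
Proof. by apply/matrixP => i j; rewrite !mxE starD. Qed.

Lemma starN a : star (- a) = - star a.
Proof. by apply/eqP; rewrite -addr_eq0 -starD addNr star0. Qed.

Lemma adjmxN m n (M : 'M[A]_(m, n)) : adjmx (- M) = - adjmx M.
Proof. by apply/matrixP => i j; rewrite !mxE starN. Qed.

Lemma mnorm_complete m n (u : nat -> 'M[A]_(m, n)) :
  (forall e : R, 0 < e -> exists N : nat, forall k k' : nat,
      (N <= k)%N -> (N <= k')%N -> mnorm (u k - u k') < e) ->
  exists L, mnorm (u k - L) @[k --> \oo] --> (0 : R).
Proof.
move=> cu.
have /choice[L Lu] (ij : 'I_m * 'I_n) : exists l,
    cnorm (u k ij.1 ij.2 - l) @[k --> \oo] --> (0 : R).
  apply: cnorm_complete => e /cu[N Nu]; exists N => k k' Nk Nk'.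
  have := cnorm_le_mnorm (u k - u k') ij.1 ij.2; rewrite !mxE => le.
  exact: le_lt_trans (Nu _ _ Nk Nk').
exists (\matrix_(i, j) L (i, j)).
have -> : (0 : R) = \sum_(i < m) \sum_(j < n) 0.
  by rewrite !big1// => i _; rewrite big1.
apply: cvg_big => [|i _]; first exact: add_continuous.
apply: cvg_big => [|j _]; first exact: add_continuous.
have := Lu (i, j) => /=; apply: cvg_trans; apply: near_eq_cvg.
by apply: nearW => k; rewrite !mxE.
Qed.

(** Banach's fixed point theorem on the ball of radius [rho]. The convergence of the iterates from
    [0] is part of the conclusion because commutation and self-adjointness of the fixed point are
    inherited from them. *)
Lemma mnorm_fixpoint m n (T : 'M[A]_(m, n) -> 'M[A]_(m, n)) (rho : R) :
  0 <= rho -> (forall z, mnorm z <= rho -> mnorm (T z) <= rho) ->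
  (forall z z', mnorm z <= rho -> mnorm z' <= rho ->
     mnorm (T z - T z') <= 2^-1 * mnorm (z - z')) ->
  exists z, [/\ mnorm z <= rho, T z = z &
    mnorm (iter k T 0 - z) @[k --> \oo] --> (0 : R)].
Proof.
move=> rho0 Trho Tlip; pose u k := iter k T 0.
have u_rho k : mnorm (u k) <= rho by elim: k => [|k /Trho]//; rewrite mnorm0.
have u_geo k p : mnorm (u (k + p)%N - u k) <= 2^-1 ^+ k * rho.
  elim: k => [|k le]; first by rewrite expr0 mul1r subr0.
  rewrite exprS -mulrA (le_trans (Tlip _ _ (u_rho _) (u_rho _)))//.
  by rewrite ler_wpM2l// invr_ge0.
have geo0 : ((2^-1 : R) ^+ k * (2 * rho)) @[k --> \oo] --> (0 : R).
  rewrite -[X in _ --> X](mul0r (2 * rho)); apply: cvgMr_tmp.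
  by apply: cvg_expr; rewrite ger0_norm ?invr_ge0// invf_lt1// ltr1n.
have [z uz] : exists z, mnorm (u k - z) @[k --> \oo] --> (0 : R).
  apply: mnorm_complete => e e0.
  have /cvgrPdist_lt/(_ e e0)[N _ /(_ N (leqnn N))] := geo0.
  rewrite /= sub0r normrN ger0_norm; last first.
    by rewrite mulr_ge0 ?exprn_ge0 ?invr_ge0// mulr_ge0.
  move=> Ne; exists N => k k' /subnKC <- /subnKC <-.
  rewrite (le_lt_trans (mnorm_dist (u N) _ _))// (le_lt_trans _ Ne)//.
  by rewrite mulrCA mulr_natl mulr2n lerD// mnormB.
exists z; split => //.
  rewrite -subr_le0; apply: (cvg0_le0 (K := 1) uz) => k.
  rewrite mul1r lerBlDl (le_trans _ (lerD (u_rho k) (lexx _)))//.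
  rewrite mnormB (le_trans _ (mnormD _ _))//.
  by rewrite addrC subrK.
apply/eqP; rewrite -subr_eq0; apply/eqP/mnorm_le0.
have z_rho : mnorm z <= rho.
  rewrite -subr_le0; apply: (cvg0_le0 (K := 1) uz) => k.
  rewrite mul1r lerBlDl (le_trans _ (lerD (u_rho k) (lexx _)))//.
  by rewrite mnormB (le_trans _ (mnormD _ _))// addrC subrK.
have uz' : (mnorm (u k - z) + mnorm (u k.+1 - z)) @[k --> \oo] --> (0 : R).
  rewrite -[X in _ --> X]addr0; apply: cvgD => //.
  by have := uz; rewrite -(cvg_shiftS (fun k => mnorm (u k - z))).
apply: (cvg0_le0 (K := 1) uz') => k; rewrite mul1r.
rewrite (le_trans (mnorm_dist (u k.+1) _ _))// lerD2r.
rewrite (le_trans (Tlip _ _ z_rho (u_rho _)))// mnormB ler_piMl ?mnorm_ge0//.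
by rewrite invf_le1// ler1n.
Qed.

End CstarNorm.

(** * Inverse square roots, and projections near approximate projections *)

Section FunctionalCalculus.
Variables (R : realType) (A : cstarAlg R) (n : nat).
Implicit Types a x y z p q w : 'M[A]_n.

Lemma mnormMn k x : mnorm (x *+ k) <= mnorm x *+ k.
Proof.
elim: k => [|k IHk]; first by rewrite !mulr0n mnorm0.
by rewrite !mulrS (le_trans (mnormD _ _))// lerD2l.
Qed.

Lemma adjmx_mul x y : adjmx (x * y) = adjmx y * adjmx x.
Proof. exact: adjmxM. Qed.

Lemma adjmxMn k x : adjmx (x *+ k) = adjmx x *+ k.
Proof. by elim: k => [|k IHk]; rewrite ?mulr0n ?adjmx0// !mulrS adjmxD IHk. Qed.

(* [1 + 2 z] is the square root of [(1 - 4 x)^-1], obtained as a fixed point of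
   [z |-> x + 4 x (z + z^2) - z^2]. *)
Lemma ex_half_invsqrt x : adjmx x = x -> mnorm x <= 32^-1 ->
  exists z, [/\ adjmx z = z, forall y, GRing.comm x y -> GRing.comm z y,
    mnorm z <= 2 * mnorm x & (z + z * z) * (1 - x *+ 4) = x].
Proof.
move=> x_adj x_le; have x0 := mnorm_ge0 x.
pose T z := x + (x *+ 4) * (z + z * z) - z * z.
have x4 : mnorm (x *+ 4) <= 8^-1.
  by rewrite (le_trans (mnormMn _ _))//; lra.
have x4' : mnorm (x *+ 4) <= 4 * mnorm x.
  by rewrite (le_trans (mnormMn _ _))// mulr_natl.
(* On the ball of radius [2 |x| <= 1/16] the term [4 x] has norm at most [1/8] and [z^2 - z'^2] has
   norm at most [1/8] times [|z - z'|]. This leaves room for both the invariance of the ball and the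
   Lipschitz constant [1/2]. *)
have rho0 : 0 <= 2 * mnorm x by lra.
have [z z_rho|z z' z_rho z'_rho|z [z_rho Tz uz]] :=
    @mnorm_fixpoint R A n n T (2 * mnorm x) rho0.
- rewrite (le_trans (mnormD _ _))// mnormN.
  have zz : mnorm (z * z) <= mnorm z * mnorm z := mnormM z z.
  have := mnormD x (x *+ 4 * (z + z * z)).
  have := mnormM (x *+ 4) (z + z * z); have := mnormD z (z * z).
  have := mnorm_ge0 z; have := mnorm_ge0 (x *+ 4); rewrite mulmxE; nra.
- set d := z - z'; pose s := z * z - z' * z'.
  have -> : T z - T z' = x *+ 4 * (d + s) - s.
    have -> : d + s = (z + z * z) - (z' + z' * z') by rewrite opprD addrACA.
    rewrite mulrBr /T /s opprB; set P := x *+ 4 * _; set P' := x *+ 4 * _.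
    rewrite opprD (addrC (z' * z')) addrACA (addrACA x) subrr add0r opprB.
    by rewrite (addrC (- (z * z))).
  have s_le : mnorm s <= (mnorm z + mnorm z') * mnorm d.
    have -> : s = z * d + d * z' by rewrite /d mulrBr mulrBl addrA subrK.
    have := mnormD (z * d) (d * z').
    have := mnormM z d; have := mnormM d z'; rewrite !mulmxE; nra.
  rewrite (le_trans (mnormD _ _))// mnormN.
  have := mnormM (x *+ 4) (d + s); have := mnormD d s.
  have := mnorm_ge0 z; have := mnorm_ge0 (x *+ 4); have := mnorm_ge0 z'.
  have := mnorm_ge0 d; have := mnorm_ge0 s; rewrite mulmxE; nra.
(* The iterates are polynomials in [x]. Each identity for [z] below is obtained by bounding its
   defect by a fixed multiple of the distance from [z] to the [k]-th iterate. *)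
have comm_u y : GRing.comm x y -> forall k, GRing.comm (iter k T 0) y.
  move=> xy; elim=> [|k IHk]; first exact/commr_sym/commr0.
  have zy : GRing.comm (iter k T 0 * iter k T 0) y.
    by apply/commr_sym/commrM; exact: commr_sym.
  apply/commr_sym/commrB; last exact: commr_sym.
  apply: commrD; first exact: commr_sym.
  apply: commrM; first exact/commrMn/commr_sym.
  by apply: commrD; exact: commr_sym.
have comm_z y : GRing.comm x y -> GRing.comm z y.
  move=> xy; apply/eqP; rewrite -subr_eq0; apply/eqP/mnorm_le0.
  apply: (cvg0_le0 (K := 2 * mnorm y) uz) => k; set u := iter k T 0.
  have -> : z * y - y * z = y * (u - z) - (u - z) * y.
    by rewrite mulrBr mulrBl opprB [RHS]addrC -(comm_u y xy k) addrA subrK.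
  rewrite (le_trans (mnormD _ _))// mnormN.
  by have := mnormM y (u - z); have := mnormM (u - z) y; rewrite !mulmxE; nra.
have adj_z : adjmx z = z.
  apply/eqP; rewrite -subr_eq0; apply/eqP/mnorm_le0.
  apply: (cvg0_le0 (K := 2) uz) => k.
  have adj_u : adjmx (iter k T 0) = iter k T 0.
    elim: k => [|k IHk]; first by rewrite adjmx0.
    rewrite /= /T adjmxD adjmxN adjmxD !adjmx_mul adjmxD adjmx_mul IHk.
    rewrite adjmxMn x_adj; congr (_ + _ - _); set u := iter k T 0.
    have ux : GRing.comm (x *+ 4) u.
      by apply/commr_sym/commrMn/comm_u.
    by apply/commr_sym/commrD => //; exact: commrM.
  rewrite (le_trans (mnorm_dist (iter k T 0) _ _))// -{1}adj_u -adjmxN -adjmxD.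
  by rewrite mnorm_adj mnormB mulr_natl mulr2n.
exists z; split => //.
have zx : GRing.comm (x *+ 4) z by apply/commr_sym/commrMn/comm_z.
have /commr_sym zx' : GRing.comm (x *+ 4) (z + z * z).
  by apply: commrD => //; exact: commrM.
rewrite mulrBr mulr1 zx'; apply/eqP; rewrite subr_eq; apply/eqP.
by rewrite -{1}Tz /T subrK.
Qed.
End FunctionalCalculus.

Section Projections.
Variables (R : realType) (A : cstarAlg R).
Local Notation C := (Cplx R).

Lemma scalMn (k : C) n : scal (k *+ n) = scal k *+ n :> A.
Proof. by elim: n => [|n IHn]; rewrite ?mulr0n ?scal0// !mulrS scalD IHn. Qed.

(** For [x = d / 4] the relation [(z + z^2) (1 - 4 x) = x] gives
    [(1 + 2 z)^2 (1 - d) = 1 - d + 4 x = 1]. *)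
Lemma ex_invsqrt n (d : 'M[A]_n) : adjmx d = d -> mnorm d <= 32^-1 ->
  exists w, [/\ adjmx w = w, forall y, GRing.comm d y -> GRing.comm w y &
    w * w * (1 - d) = 1].
Proof.
move=> d_adj d_le; pose k : C := 4^-1; pose x := (scal k : A) *: d.
have x4 : x *+ 4 = d.
  apply/matrixP => i j; rewrite mulmxnE mxE -mulrnAl -scalMn.
  by rewrite -mulr_natl divff ?pnatr_eq0// scal1 mul1r.
have x_adj : adjmx x = x.
  apply/matrixP => i j; rewrite !mxE starM -[in RHS]d_adj !mxE scalC.
  by rewrite star_scal fmorphV rmorph_nat.
have x_le : mnorm x <= mnorm d.
  do 2!apply: ler_sum => ? _; rewrite mxE cnorm_scal ler_piMl ?cnorm_ge0//.
  have : Normc.normc (k *+ 4) = 1.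
    by rewrite -mulr_natl divff ?pnatr_eq0// Normc.normc1.
  by rewrite normcMn -mulr_natl; lra.
have [z [z_adj z_comm _ zx]] := ex_half_invsqrt x_adj (le_trans x_le d_le).
have dz : GRing.comm x d by rewrite -x4; exact/commrMn.
exists (1 + z *+ 2); split.
- by rewrite adjmxD adjmx1 adjmxMn z_adj.
- move=> y dy; have xy : GRing.comm x y.
    rewrite /GRing.comm -!mulmxE -scalemxAl mulmxE dy.
    apply/matrixP => i j; rewrite !mxE mulr_sumr; apply: eq_bigr => l _.
    by rewrite mxE !mulrA scalC.
  apply/commr_sym/commrD; first exact: commr1.
  exact/commrMn/commr_sym/z_comm.
- have -> : (1 + z *+ 2) * (1 + z *+ 2) = 1 + (z + z * z) *+ 4.
    rewrite mulrDl mul1r mulrDr mulr1 -addrA; congr (_ + _).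
    by rewrite addrA -mulrnDr mulrnAl mulrnAr -mulrnA mulrnDl.
  by rewrite mulrDl mul1r mulrnAl -[d]x4 zx subrK.
Qed.

(* With [x = a - a^2] the element [s = (2 a - 1) (1 - 4 x)^(-1/2)] is a
   self-adjoint square root of [1], and [p = (1 + s) / 2]. *)
Lemma ex_near_projmx n (a : 'M[A]_n) : adjmx a = a ->
  mnorm (a - a * a) <= 32^-1 ->
  exists p, projmx p /\
    mnorm (p - a) <= (2 * mnorm a + 1) * (2 * mnorm (a - a * a)).
Proof.
move=> a_adj; set x := a - a * a => x_le.
have x_adj : adjmx x = x by rewrite adjmxD adjmxN adjmx_mul a_adj.
have [z [z_adj z_comm z_le zx]] := ex_half_invsqrt x_adj x_le.
have xa : GRing.comm x a.
  by apply/commr_sym/commrB => //; apply: commrM.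
have za : GRing.comm z a := z_comm _ xa.
have xz : GRing.comm x z by apply/commr_sym/z_comm.
pose b := a *+ 2 - 1.
have ab : GRing.comm a b by apply: commrB; [exact: commrMn | exact: commr1].
have zb : GRing.comm z b by apply: commrB; [exact: commrMn | exact: commr1].
(* For [s = b (1 + 2 z)] the projection [(1 + s) / 2] equals [(1 + b) / 2 + b z = a + b z], so that
   no division by [2] is left. *)
exists (a + b * z); split; first split.
- by rewrite adjmxD adjmx_mul z_adj adjmxD adjmxN adjmx1 adjmxMn a_adj zb.
- have bb : b * b = 1 - x *+ 4.
    rewrite mulrBl mul1r mulrBr mulr1 mulrnAl mulrnAr -mulrnA mulrnBl !opprB.
    by rewrite addrCA -(addrA (_ *+ _)) -opprD -mulrnDr.
  have bzz : b * b * (z + z * z) = x.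
    rewrite bb -[RHS]zx; apply/commr_sym/commrB; first exact: commr1.
    by apply/commrMn/commr_sym/commrD => //; exact: commrM.
  (* With [2 a = b + 1] the square of [a + b z] becomes [a^2 + b^2 (z + z^2) + b z = a^2 + x + b z],
     which is [a + b z]. *)
  have bE : a *+ 2 = b + 1 by rewrite subrK.
  clearbody b; rewrite mulmxE mulrDl !mulrDr -(mulrA b z a) za (mulrA b a) -ab.
  have -> : b * z * (b * z) = b * b * (z * z).
    by rewrite -!(mulrA b) (mulrA z b) zb -(mulrA b).
  rewrite -(mulrA a) addrA -(addrA (a * a)) -mulr2n -mulrnAl bE mulrDl mul1r.
  rewrite (mulrA b b z) addrAC -addrA (addrA (_ * (z * z))) -mulrDr (addrC (z * z)).
  by rewrite bzz addrA (addrC (a * a)) subrK.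
(* Expanding [b z] as [2 a z - z] produces the factor [2 |a| + 1] and avoids the norm of [1]. *)
- rewrite addrAC subrr add0r mulrBl mul1r (le_trans (mnormD _ _))// mnormN.
  have := mnormM (a *+ 2) z; have := mnormMn 2 a; have := mnorm_ge0 z.
  by rewrite mulmxE mulr2n; have := mnorm_ge0 a; nra.
Qed.

(* [d = (p - q)^2] commutes with [p] and [q], and [p q p = p (1 - d)], so that
   [q p (1 - d)^(-1/2)] is a partial isometry from [p] to [q]. *)
Lemma close_projmx_mvn n (p q : 'M[A]_n) (pP : projmx p) (qP : projmx q) :
  mnorm (p - q) <= 32^-1 -> mvn_equivalent (MatProj pP) (MatProj qP).
Proof.
move=> pq; have [p1 pp] := pP; have [q1 qq] := qP.
have {}pp : p * p = p := pp; have {}qq : q * q = q := qq.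
pose d := (p - q) * (p - q).
have d_adj : adjmx d = d by rewrite adjmx_mul adjmxD adjmxN p1 q1.
have d_le : mnorm d <= 32^-1.
  have := mnormM (p - q) (p - q); have := mnorm_ge0 (p - q).
  by rewrite mulmxE; nra.
have [w [w1 w_comm w2]] := ex_invsqrt d_adj d_le.
have dE : d = p + q - p * q - q * p.
  by rewrite /d mulrBl !mulrBr pp qq opprB addrA (addrAC p).
have pd : p * d = p - p * q * p.
  rewrite dE !mulrBr mulrDr !mulrA pp.
  by rewrite addrK.
have dp : d * p = p - p * q * p.
  rewrite dE !mulrBl mulrDl -!mulrA pp.
  by rewrite addrAC addrK mulrA.
have qd : q * d = q - q * p * q.
  rewrite dE !mulrBr mulrDr !mulrA qq.
  by rewrite addrAC (addrC (q * p)) addrK.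
have dq : d * q = q - q * p * q.
  rewrite dE !mulrBl mulrDl -!mulrA qq.
  by rewrite (addrC (p * q)) addrK mulrA.
have wp : GRing.comm w p by apply: w_comm; rewrite /GRing.comm dp pd.
have wq : GRing.comm w q by apply: w_comm; rewrite /GRing.comm dq qd.
have wd : GRing.comm w d by apply: w_comm.
have pqp : p * q * p = p * (1 - d) by rewrite mulrBr mulr1 pd subKr.
have qpq : q * p * q = q * (1 - d) by rewrite mulrBr mulr1 qd subKr.
have w2' : w * (1 - d) * w = 1.
  have /= h : GRing.comm w (1 - d) by apply: commrB => //; exact: commr1.
  by rewrite -mulrA -h mulrA.
have wwq : GRing.comm (w * w) q by apply/commr_sym/commrM; exact/commr_sym.
have wwqp : GRing.comm (w * w) (q * p).
  by apply: commrM => //; apply/commr_sym/commrM; exact/commr_sym.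
exists (q *m p *m w); rewrite !adjmxM /= p1 q1 w1 !mulmxE; split.
- have -> : w * (p * q) * (q * p * w) = w * (p * q * p) * w.
    by rewrite -!mulrA (mulrA q q) qq.
  by rewrite pqp mulrA wp -!mulrA (mulrA w) w2' mulr1.
- have -> : q * p * w * (w * (p * q)) = w * w * (q * p * q).
    by rewrite -(mulrA (q * p)) (mulrA w w) mulrA -wwqp -!mulrA (mulrA p p) pp.
  by rewrite qpq mulrA wwq -mulrA w2 mulr1.
Qed.

End Projections.

(** * The operator norm and the C*-algebras of the system *)

Lemma sum_Cauchy_Schwarz (R : rcfType) (I : finType) (a b : I -> R) :
  \sum_i a i * b i <=
  Num.sqrt (\sum_i a i ^+ 2) * Num.sqrt (\sum_i b i ^+ 2).
Proof.
have a2 : 0 <= \sum_i a i ^+ 2 by apply: sumr_ge0 => i _; exact: sqr_ge0.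
rewrite -sqrtrM// (le_trans (ler_norm _))// -sqrtr_sqr ler_wsqrtr//.
set S := \sum_i a i * b i; set x := \sum_i a i ^+ 2; set y := \sum_i b i ^+ 2.
(* Both sides are doubled so that the double sum can be symmetrised in its two indices; termwise the
   difference is then the square of [a i * b j - a j * b i]. *)
suff : S * S *+ 2 <= x * y + x * y by rewrite -mulr2n lerMn2r.
rewrite {2}[x * y]mulrC !big_distrlr -big_split /= -sumrMnl.
apply: ler_sum => i _; rewrite -sumrMnl -big_split /=; apply: ler_sum => j _.
by have := sqr_ge0 (a i * b j - a j * b i); nra.
Qed.

Section OperatorNorm.
Variable R : realType.
Local Notation C := (Cplx R).
Local Notation normc := (@Normc.normc R).

Lemma normc_ge0 (z : C) : 0 <= normc z.
Proof. by case: z => a b; exact: sqrtr_ge0. Qed.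

Lemma normC_normc (z : C) : `|z| = ((normc z)%:C)%C.
Proof. by case: z => a b; rewrite normc_def. Qed.

Lemma normc_conj (z : C) : normc z^* = normc z.
Proof. by apply: (@complexI R); rewrite -!normC_normc norm_conjC. Qed.

Lemma ler_normc_sum I (s : seq I) (F : I -> C) :
  normc (\sum_(i <- s) F i) <= \sum_(i <- s) normc (F i).
Proof.
elim/big_rec2: _ => [|i x y _ le]; first by rewrite Normc.normc0.
by rewrite (le_trans (le_normcD _ _))// lerD2l.
Qed.

Lemma vnorm_ge0 k (v : 'cV[C]_k) : 0 <= vnorm v.
Proof. exact: sqrtr_ge0. Qed.

Lemma vnorm_sqr k (v : 'cV[C]_k) : vnorm v ^+ 2 = \sum_i normc (v i 0) ^+ 2.
Proof. by rewrite sqr_sqrtr// sumr_ge0// => i _; exact: sqr_ge0. Qed.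

Lemma normc_le_vnorm k (v : 'cV[C]_k) i : normc (v i 0) <= vnorm v.
Proof.
rewrite -ler_sqr ?nnegrE ?normc_ge0 ?vnorm_ge0// vnorm_sqr (bigD1 i)//= lerDl.
by apply: sumr_ge0 => j _; exact: sqr_ge0.
Qed.

Lemma vnorm_le_sum k (v : 'cV[C]_k) : vnorm v <= \sum_i normc (v i 0).
Proof.
have s0 : 0 <= \sum_i normc (v i 0) by apply: sumr_ge0 => i _; exact: normc_ge0.
rewrite -ler_sqr ?nnegrE ?vnorm_ge0// vnorm_sqr [leRHS]expr2 mulr_suml.
apply: ler_sum => i _; rewrite expr2 ler_wpM2l ?normc_ge0//.
by rewrite (bigD1 i)//= lerDl; apply: sumr_ge0 => j _; exact: normc_ge0.
Qed.

Lemma vnormZ k (c : C) (v : 'cV[C]_k) : vnorm (c *: v) = normc c * vnorm v.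
Proof.
apply/eqP; rewrite -(@eqrXn2 _ 2)// ?mulr_ge0 ?normc_ge0 ?vnorm_ge0//.
rewrite exprMn !vnorm_sqr mulr_sumr; apply/eqP/eq_bigr => i _.
by rewrite mxE Normc.normcM exprMn.
Qed.

Lemma vnormD k (u v : 'cV[C]_k) : vnorm (u + v) <= vnorm u + vnorm v.
Proof.
rewrite -ler_sqr ?nnegrE ?addr_ge0 ?vnorm_ge0// sqrrD !vnorm_sqr.
have CS : \sum_i normc (u i 0) * normc (v i 0) <= vnorm u * vnorm v.
  exact: sum_Cauchy_Schwarz.
suff : \sum_i normc ((u + v) i 0) ^+ 2 <= \sum_i normc (u i 0) ^+ 2 +
    (\sum_i normc (u i 0) * normc (v i 0)) *+ 2 + \sum_i normc (v i 0) ^+ 2.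
  by rewrite !mulr2n; lra.
rewrite -sumrMnl -!big_split /=; apply: ler_sum => i _; rewrite mxE -sqrrD.
by rewrite ler_sqr ?nnegrE ?addr_ge0 ?normc_ge0// le_normcD.
Qed.

Lemma vnorm0 k : vnorm (0 : 'cV[C]_k) = 0.
Proof. by rewrite -(scale0r 0) vnormZ Normc.normc0 mul0r. Qed.

Lemma vnorm_eq0 k (v : 'cV[C]_k) : vnorm v = 0 -> v = 0.
Proof.
move=> v0; apply/matrixP => i j; rewrite ord1 mxE.
by apply: Normc.eq0_normc; apply/le_anti; rewrite normc_ge0 -v0 normc_le_vnorm.
Qed.

Definition conj_trmx m n (M : 'M[C]_(m, n)) : 'M[C]_(n, m) := (map_mx Num.conj M)^T.

Lemma conj_trmxM m n p (M : 'M[C]_(m, n)) (N : 'M[C]_(n, p)) :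
  conj_trmx (M *m N) = conj_trmx N *m conj_trmx M.
Proof. by rewrite /conj_trmx map_mxM trmx_mul. Qed.

Lemma conj_trmxK m n (M : 'M[C]_(m, n)) : conj_trmx (conj_trmx M) = M.
Proof. by apply/matrixP => i j; rewrite !mxE conjCK. Qed.

Lemma conj_trmx_vnorm k (v : 'cV[C]_k) :
  (conj_trmx v *m v) 0 0 = ((vnorm v ^+ 2)%:C)%C :> C.
Proof.
rewrite vnorm_sqr raddf_sum mxE; apply: eq_bigr => i _.
by rewrite !mxE mulrC -normCK normC_normc -rmorphXn.
Qed.

Lemma conj_trmx_le_vnorm k (u v : 'cV[C]_k) :
  normc ((conj_trmx u *m v) 0 0) <= vnorm u * vnorm v.
Proof.
rewrite mxE (le_trans (ler_normc_sum _ _))//.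
apply: le_trans (sum_Cauchy_Schwarz _ _).
by apply: ler_sum => i _; rewrite !mxE Normc.normcM normc_conj.
Qed.

(** A crude bound for the operator norm. It shows that the supremum defining [opnorm] is a genuine
    one, and it turns entrywise estimates into estimates of [opnorm]. *)
Definition entry_sum m n (M : 'M[C]_(m, n)) : R := \sum_i \sum_j normc (M i j).

Lemma vnorm_mul_entry_sum m n (M : 'M[C]_(m, n)) v :
  vnorm (M *m v) <= entry_sum M * vnorm v.
Proof.
rewrite (le_trans (vnorm_le_sum _))// mulr_suml; apply: ler_sum => i _.
rewrite mxE (le_trans (ler_normc_sum _ _))// mulr_suml; apply: ler_sum => j _.
by rewrite Normc.normcM ler_wpM2l ?normc_ge0// normc_le_vnorm.
Qed.

Section SquareMatrices.
Variable k : nat.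
Implicit Types (M N : 'M[C]_k) (v : 'cV[C]_k).

Lemma opnorm_has_sup M : has_sup [set vnorm (M *m v) | v in [set v | vnorm v <= 1]].
Proof.
split; first by exists (vnorm (M *m 0)), 0 => //=; rewrite vnorm0.
exists (entry_sum M) => _ [v /= v1 <-]; rewrite (le_trans (vnorm_mul_entry_sum _ _))//.
by rewrite ler_piMr//; do 2!apply: sumr_ge0 => ? _; exact: normc_ge0.
Qed.

Lemma opnorm_ge0 M : 0 <= opnorm M.
Proof.
apply: le_trans (vnorm_ge0 (M *m 0)) _.
by apply: (sup_upper_bound (opnorm_has_sup M)); exists 0 => //=; rewrite vnorm0.
Qed.

Lemma vnorm_mulmx M v : vnorm (M *m v) <= opnorm M * vnorm v.
Proof.
have [v0|v0] := eqVneq (vnorm v) 0.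
  by rewrite (vnorm_eq0 v0) mulmx0 vnorm0 mulr0.
have v_gt0 : 0 < vnorm v by rewrite lt_def v0 vnorm_ge0.
pose c : C := ((vnorm v)^-1%:C)%C.
have nc : normc c = (vnorm v)^-1.
  apply: (@complexI R); rewrite -normC_normc ger0_norm//.
  by rewrite ler0c invr_ge0 vnorm_ge0.
rewrite -ler_pdivrMr// mulrC -nc -vnormZ scalemxAr.
apply: (sup_upper_bound (opnorm_has_sup M)); exists (c *: v) => //=.
by rewrite vnormZ nc mulVf.
Qed.

Lemma opnorm_le M (c : R) : 0 <= c ->
  (forall v, vnorm (M *m v) <= c * vnorm v) -> opnorm M <= c.
Proof.
move=> c0 Mc; apply: ge_sup; first by case: (opnorm_has_sup M).
by move=> _ [v /= v1 <-]; rewrite (le_trans (Mc v))// ler_piMr.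
Qed.

Lemma opnorm_le_entry_sum M : opnorm M <= entry_sum M.
Proof.
apply: opnorm_le => [|v]; last exact: vnorm_mul_entry_sum.
by do 2!apply: sumr_ge0 => ? _; exact: normc_ge0.
Qed.

Lemma normc_le_opnorm M i j : normc (M i j) <= opnorm M.
Proof.
have e1 : vnorm (delta_mx j 0 : 'cV[C]_k) = 1.
  rewrite /vnorm (bigD1 j)//= mxE !eqxx Normc.normc1 expr1n big1 ?addr0 ?sqrtr1//.
  by move=> l lj; rewrite mxE (negbTE lj) Normc.normc0 expr0n.
have := vnorm_mulmx M (delta_mx j 0); rewrite e1 mulr1; apply: le_trans.
by rewrite -colE; have := normc_le_vnorm (col j M) i; rewrite mxE.
Qed.

Lemma opnormD M N : opnorm (M + N) <= opnorm M + opnorm N.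
Proof.
apply: opnorm_le => [|v]; first by rewrite addr_ge0 ?opnorm_ge0.
by rewrite mulmxDl mulrDl (le_trans (vnormD _ _))// lerD ?vnorm_mulmx.
Qed.

Lemma opnormM M N : opnorm (M *m N) <= opnorm M * opnorm N.
Proof.
apply: opnorm_le => [|v]; first by rewrite mulr_ge0 ?opnorm_ge0.
rewrite -mulmxA (le_trans (vnorm_mulmx _ _))// -mulrA ler_wpM2l ?opnorm_ge0//.
exact: vnorm_mulmx.
Qed.

Lemma opnormZ (c : C) M : opnorm (c%:M *m M) = normc c * opnorm M.
Proof.
have le d N : opnorm (d%:M *m N) <= normc d * opnorm N.
  apply: opnorm_le => [|v]; first by rewrite mulr_ge0 ?opnorm_ge0 ?normc_ge0.
  rewrite -mulmxA mul_scalar_mx vnormZ -mulrA ler_wpM2l ?normc_ge0//.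
  exact: vnorm_mulmx.
apply/le_anti; rewrite le /=; have [->|c0] := eqVneq c 0.
  by rewrite Normc.normc0 mul0r opnorm_ge0.
(* The reverse inequality is the bound just proved, for the scalar [c^-1] and the matrix [c M]. *)
have := le c^-1 (c%:M *m M); rewrite mulmxA -scalar_mxM mulVf// mul1mx.
have c_gt0 : 0 < normc c.
  by rewrite lt_def normc_ge0 andbT; apply: contra c0 => /eqP/Normc.eq0_normc ->.
by rewrite Normc.normcV// mulrC ler_pdivlMr// mulrC.
Qed.

(** By Cauchy-Schwarz [|N v|^2 = <v, N^* N v> <= |N^* N| |v|^2], which is [sq]. Submultiplicativity
    then allows cancelling [|N|], so that [|N| <= |N^*|] for every [N]; applied to the adjoint of
    [M], this gives the other inequality. *)
Lemma opnorm_conj_trmxM M : opnorm (conj_trmx M *m M) = opnorm M ^+ 2.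
Proof.
have sq N : opnorm N ^+ 2 <= opnorm (conj_trmx N *m N).
  rewrite -[leRHS]sqr_sqrtr ?opnorm_ge0// ler_sqr ?nnegrE ?opnorm_ge0 ?sqrtr_ge0//.
  apply: opnorm_le => [|v]; first exact: sqrtr_ge0.
  rewrite -ler_sqr ?nnegrE ?mulr_ge0 ?sqrtr_ge0 ?vnorm_ge0//.
  rewrite exprMn [in leRHS]sqr_sqrtr ?opnorm_ge0//.
  have -> : vnorm (N *m v) ^+ 2 = normc ((conj_trmx (N *m v) *m (N *m v)) 0 0).
    apply: (@complexI R); rewrite -normC_normc conj_trmx_vnorm ger0_norm//.
    by rewrite ler0c sqr_ge0.
  rewrite conj_trmxM -mulmxA (le_trans (conj_trmx_le_vnorm _ _))// mulmxA.
  by rewrite expr2 [leRHS]mulrCA ler_wpM2l ?vnorm_ge0 ?vnorm_mulmx.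
have le N : opnorm N <= opnorm (conj_trmx N).
  have [->|N0] := eqVneq (opnorm N) 0; first exact: opnorm_ge0.
  have N_gt0 : 0 < opnorm N by rewrite lt_def N0 opnorm_ge0.
  have := le_trans (sq N) (opnormM (conj_trmx N) N).
  by rewrite expr2 (ler_pM2r N_gt0).
apply/le_anti/andP; split; last exact: sq.
apply: le_trans (opnormM _ _) _; rewrite expr2.
apply: ler_pM (opnorm_ge0 _) (opnorm_ge0 _) _ (lexx _).
by have := le (conj_trmx M); rewrite conj_trmxK.
Qed.

End SquareMatrices.
End OperatorNorm.

(** * Continuous matrix functions and finite direct sums as C*-algebras *)

Section ComplexTopology.
Variable R : realType.
Local Notation C := (Cplx R).
Local Notation normc := (@Normc.normc R).

Lemma ltr0c (e : R) : (0 < (e%:C)%C :> C) = (0 < e).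
Proof. by rewrite ltcE /= eqxx. Qed.

Lemma near_normc (Y : topologicalType) (g : Y -> C) (y : Y) (e : R) : 0 < e ->
  {for y, continuous g} -> \forall z \near y, normc (g z - g y) < e.
Proof.
move=> e0 /cvgrPdist_lt/(_ (e%:C)%C); rewrite ltr0c => /(_ e0).
by apply: filterS => z; rewrite distrC normC_normc ltcR.
Qed.

Lemma continuous_normc (Y : topologicalType) (g : Y -> C) (y : Y) :
  (forall e : R, 0 < e -> \forall z \near y, normc (g z - g y) < e) ->
  {for y, continuous g}.
Proof.
move=> gc; apply/cvgrPdist_lt => e e0.
have eE : e = ((complex.Re e)%:C)%C by rewrite RRe_real// gtr0_real.
have : 0 < complex.Re e by rewrite -ltr0c -eE.
by move=> /gc; apply: filterS => z; rewrite distrC normC_normc eE ltcR.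
Qed.

Lemma normc_cauchy_cvg (u : nat -> C) :
  (forall e : R, 0 < e -> exists N : nat, forall m n : nat,
     (N <= m)%N -> (N <= n)%N -> normc (u m - u n) < e) ->
  exists l, normc (u n - l) @[n --> \oo] --> (0 : R).
Proof.
move=> cu.
have le_re (z : C) : `|complex.Re z| <= normc z.
  by have := normc_ge_Re z; rewrite normC_normc lecR.
have le_im (z : C) : `|complex.Im z| <= normc z.
  by case: z => a b /=; rewrite -sqrtr_sqr ler_wsqrtr// lerDr sqr_ge0.
have real_cvg (v : nat -> R) :
    (forall m n, `|v m - v n| <= normc (u m - u n)) -> cvg (v @ \oo).
  move=> vu; apply: cauchy_cvg; apply: cauchy_exP => e /cu[N Nu].
  exists (v N), N => // n /= Nn; apply: le_lt_trans (Nu _ _ (leqnn N) Nn).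
  exact: vu.
have /cvg_ex[a ua] : cvg ((fun n => complex.Re (u n)) @ \oo).
  apply: real_cvg => m n; apply: le_trans (le_re _).
  by case: (u m) (u n) => ? ? [].
have /cvg_ex[b ub] : cvg ((fun n => complex.Im (u n)) @ \oo).
  apply: real_cvg => m n; apply: le_trans (le_im _).
  by case: (u m) (u n) => ? ? [].
exists (Complex a b).
have ab0 : (`|complex.Re (u n) - a| + `|complex.Im (u n) - b|) @[n --> \oo]
    --> (0 : R).
  rewrite -[X in _ --> X]addr0; apply: cvgD.
    rewrite -(normr0 R) -(subrr a); apply: cvg_norm; apply: cvgB => //.
    exact: cvg_cst.
  rewrite -(normr0 R) -(subrr b); apply: cvg_norm; apply: cvgB => //.
  exact: cvg_cst.
apply: (squeeze_cvgr _ (cvg_cst 0) ab0); apply: nearW => n; rewrite normc_ge0/=.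
case: (u n) => c d /=.
rewrite -ler_sqr ?nnegrE ?addr_ge0 ?sqrtr_ge0// sqr_sqrtr ?addr_ge0 ?sqr_ge0//.
rewrite [leRHS]sqrrD !real_normK ?num_real// addrAC lerDl.
by rewrite mulrn_wge0// mulr_ge0.
Qed.

End ComplexTopology.

Section ContinuousMatrixAlgebra.
Variables (R : realType) (Y : topologicalType) (k : nat).
Hypotheses (Yc : compact [set: Y]) (y0 : Y).
Local Notation C := (Cplx R).
Local Notation B := (cmx R Y k).
Local Notation normc := (@Normc.normc R).
Implicit Types f g : B.

Lemma entry_sum_le m n (M : 'M[C]_(m, n)) (d : R) :
  (forall i j, normc (M i j) <= d) -> entry_sum M <= (m * n)%:R * d.
Proof.
move=> Md; rewrite natrM -mulrA; apply: (@le_trans _ _ (\sum_(i < m) \sum_(j < n) d)).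
  by do 2!apply: ler_sum => ? _.
by rewrite !sumr_const !card_ord !mulr_natl.
Qed.

Lemma near_opnorm (f : Y -> 'M[C]_k) y (e : R) : 0 < e ->
  (forall i j, {for y, continuous (fun z => f z i j)}) ->
  \forall z \near y, opnorm (f z - f y) < e.
Proof.
(* The successor keeps the denominator nonzero for [k = 0] and makes the final inequality strict. *)
move=> e0 fc; pose d := e / (k * k).+1%:R.
have d0 : 0 < d by rewrite divr_gt0.
have : \forall z \near y, forall i j, normc ((f z - f y) i j) < d.
  apply: (@filter_forall Y 'I_k (fun i z => forall j, normc ((f z - f y) i j) < d)).
  move=> i.
  apply: (@filter_forall Y 'I_k (fun j z => normc ((f z - f y) i j) < d)) => j.
  have := near_normc d0 (fc i j); apply: filterS => z.
  by rewrite !mxE.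
apply: filterS => z zd; rewrite (le_lt_trans (opnorm_le_entry_sum _))//.
rewrite (le_lt_trans (entry_sum_le (fun i j => ltW (zd i j))))//.
by rewrite /d mulrCA gtr_pMr// ltr_pdivrMr// mul1r ltr_nat.
Qed.

(** Compactness is used as a near-covering property for the filter of real numbers [r] tending to
    infinity. Near each point [x] the norm stays below [opnorm (f x) + 1], hence below every large
    [r]; so one [r] works on all of [Y]. *)
Lemma cmx_norm_has_sup f : has_sup (range (fun y => opnorm (f y))).
Proof.
split; first by exists (opnorm (f y0)), y0.
have /compact_near_coveringP/(_ R +oo%R (fun r y => opnorm (f y) <= r)) := Yc.
case=> [x _|r [_ h]].
  have := near_opnorm (f := f) ltr01 (fun i j => @cmx_entry _ _ _ f i j x).
  move=> h; exists ([set z | opnorm (f z - f x) < 1], [set r | opnorm (f x) + 1 < r]).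
    by split => //; exists (opnorm (f x) + 1); split => //; rewrite num_real.
  move=> [z r] [/= z1 r1]; rewrite (le_trans _ (ltW r1))// -[f z](subrK (f x)).
  by apply: le_trans (opnormD _ _) _; rewrite [leRHS]addrC lerD2r ltW.
exists (r + 1) => _ [y _ <-]; apply: (h (r + 1)) => //.
by rewrite ltrDl.
Qed.

Lemma opnorm_le_cmx_norm f y : opnorm (f y) <= cmx_norm f.
Proof. by apply: (sup_upper_bound (cmx_norm_has_sup f)); exists y. Qed.

Lemma cmx_norm_le f (c : R) : (forall y, opnorm (f y) <= c) -> cmx_norm f <= c.
Proof.
move=> fc; apply: ge_sup; first by case: (cmx_norm_has_sup f).
by move=> _ [y _ <-].
Qed.

Lemma cmx_norm_ge0 f : 0 <= cmx_norm f.
Proof. exact: le_trans (opnorm_ge0 _) (opnorm_le_cmx_norm f y0). Qed.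

Fact cmx_norm_eq0 f : cmx_norm f = 0 -> f = 0.
Proof.
move=> f0; apply: cmxP => y; apply/matrixP => i j; rewrite mxE.
apply: Normc.eq0_normc; apply/le_anti; rewrite normc_ge0 andbT -f0.
exact: le_trans (normc_le_opnorm _ _ _) (opnorm_le_cmx_norm _ _).
Qed.

Fact cmx_norm_triangle f g : cmx_norm (f + g) <= cmx_norm f + cmx_norm g.
Proof.
apply: cmx_norm_le => y; rewrite (le_trans (opnormD _ _))//.
by rewrite lerD ?opnorm_le_cmx_norm.
Qed.

Fact cmx_norm_mul f g : cmx_norm (f * g) <= cmx_norm f * cmx_norm g.
Proof.
apply: cmx_norm_le => y; rewrite (le_trans (opnormM _ _))//.
by rewrite ler_pM ?opnorm_ge0 ?opnorm_le_cmx_norm.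
Qed.

Fact cmx_norm_scal (c : R[i]) f :
  cmx_norm (scal (c : C) * f) = Normc.normc c * cmx_norm f.
Proof.
apply/le_anti/andP; split.
  apply: cmx_norm_le => y; rewrite [opnorm _]opnormZ ler_wpM2l ?normc_ge0//.
  exact: opnorm_le_cmx_norm.
have [->|c0] := eqVneq (normc c) 0; first by rewrite mul0r cmx_norm_ge0.
have c_gt0 : 0 < normc c by rewrite lt_def c0 normc_ge0.
rewrite mulrC -ler_pdivlMr//; apply: cmx_norm_le => y.
by rewrite ler_pdivlMr// mulrC -opnormZ (opnorm_le_cmx_norm (scal (c : C) * f) y).
Qed.

Fact cmx_norm_star f : cmx_norm (star f * f) = cmx_norm f ^+ 2.
Proof.
apply/le_anti/andP; split.
  apply: cmx_norm_le => y; rewrite [opnorm _]opnorm_conj_trmxM.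
  by rewrite ler_sqr ?nnegrE ?opnorm_ge0 ?cmx_norm_ge0// opnorm_le_cmx_norm.
rewrite -[leRHS]sqr_sqrtr ?cmx_norm_ge0//.
rewrite ler_sqr ?nnegrE ?cmx_norm_ge0 ?sqrtr_ge0//; apply: cmx_norm_le => y.
rewrite -[leLHS]ger0_norm ?opnorm_ge0// -sqrtr_sqr ler_wsqrtr//.
by rewrite -opnorm_conj_trmxM (opnorm_le_cmx_norm (star f * f) y).
Qed.

Fact cmx_norm_complete (u : nat -> B) :
  (forall e : R, 0 < e -> exists N : nat, forall m n : nat,
     (N <= m)%N -> (N <= n)%N -> cmx_norm (u m - u n) < e) ->
  exists l, cmx_norm (u n - l) @[n --> \oo] --> (0 : R).
Proof.
move=> cu.
have uE m n y i j : normc (u m y i j - u n y i j) <= cmx_norm (u m - u n).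
  apply: le_trans (opnorm_le_cmx_norm _ y).
  by have := normc_le_opnorm ((u m - u n) y) i j; rewrite !mxE.
have /choice[L uL] (t : Y * ('I_k * 'I_k)) : exists l,
    normc (u n t.1 t.2.1 t.2.2 - l) @[n --> \oo] --> (0 : R).
  apply: normc_cauchy_cvg => e /cu[N Nu]; exists N => m n Nm Nn.
  exact: le_lt_trans (uE _ _ _ _ _) (Nu _ _ Nm Nn).
(* Letting [m] tend to infinity in the Cauchy estimate keeps [N] independent of the point and of the
   entry. This uniformity is what makes the limit continuous. *)
have unif (e : R) : 0 < e -> exists N : nat, forall n, (N <= n)%N ->
    forall y i j, normc (u n y i j - L (y, (i, j))) <= e.
  move=> /cu[N Nu]; exists N => n Nn y i j; rewrite -subr_le0.
  apply: ler_cvg_to (cvg_cst _) (uL (y, (i, j))) _.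
  exists N => // m /= Nm; rewrite lerBlDr.
  have -> : u n y i j - L (y, (i, j)) =
      (u m y i j - L (y, (i, j))) + (u n y i j - u m y i j).
    by ring.
  rewrite (le_trans (le_normcD _ _))// lerD2l (le_trans (uE _ _ _ _ _))//.
  by rewrite ltW// Nu.
have Lc : continuous (fun y => \matrix_(i, j) L (y, (i, j)) : 'M[C]_k).
  apply: continuous_entry => i j; rewrite (_ : (fun y => _) = fun y => L (y, (i, j))).
    move=> y; apply: continuous_normc => e e0; have e3 : 0 < e / 3 by rewrite divr_gt0.
    have [N /(_ _ (leqnn N)) Nu] := unif _ e3.
    have := near_normc e3 (@cmx_entry _ _ _ (u N) i j y); apply: filterS => z.
    have -> : L (z, (i, j)) - L (y, (i, j)) = (u N z i j - u N y i j) +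
      ((u N y i j - L (y, (i, j))) - (u N z i j - L (z, (i, j)))).
      by ring.
    have := le_normcD (u N z i j - u N y i j)
      ((u N y i j - L (y, (i, j))) - (u N z i j - L (z, (i, j)))).
    have := le_normcD (u N y i j - L (y, (i, j))) (- (u N z i j - L (z, (i, j)))).
    rewrite normcN; have := Nu y i j; have := Nu z i j; lra.
  by apply/funext => y; rewrite mxE.
exists (Cmx Lc); apply/cvgrPdist_lt => e e0.
have d0 : 0 < e / (k * k).+1%:R by rewrite divr_gt0.
have [N Nu] := unif _ d0; exists N => // n /= /Nu nu.
rewrite sub0r normrN ger0_norm ?cmx_norm_ge0//.
apply: (@le_lt_trans _ _ ((k * k)%:R * (e / (k * k).+1%:R))); last first.
  by rewrite mulrCA gtr_pMr// ltr_pdivrMr// mul1r ltr_nat.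
apply: cmx_norm_le => y; rewrite (le_trans (opnorm_le_entry_sum _))//.
by apply: entry_sum_le => i j; rewrite !mxE.
Qed.

Definition cmx_cstar : cstarAlg R :=
  CstarAlg cmx_norm_eq0 cmx_norm_triangle cmx_norm_scal cmx_norm_mul
    cmx_norm_star cmx_norm_complete.

End ContinuousMatrixAlgebra.

Section DirectSumAlgebra.
Variables (R : realType) (m : nat) (B : 'I_m -> cstarAlg R).
Local Notation D := (dsum (fun j => B j : starAlgType (Cplx R))).
Implicit Types a b : D.

Definition dsum_norm a : R := \big[Num.max/0]_j cnorm (a j).

Lemma cnorm_le_dsum_norm a j : cnorm (a j) <= dsum_norm a.
Proof. exact: le_bigmax. Qed.

Lemma dsum_norm_ge0 a : 0 <= dsum_norm a.
Proof. exact: bigmax_ge_id. Qed.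

Lemma dsum_norm_le a (c : R) : 0 <= c -> (forall j, cnorm (a j) <= c) ->
  dsum_norm a <= c.
Proof. by move=> c0 ac; apply: bigmax_le. Qed.

Fact dsum_norm_eq0 a : dsum_norm a = 0 -> a = 0.
Proof.
move=> a0; apply: dsumP => j; apply: cnorm_eq0; apply/le_anti.
by rewrite cnorm_ge0 andbT -a0 cnorm_le_dsum_norm.
Qed.

Fact dsum_norm_triangle a b : dsum_norm (a + b) <= dsum_norm a + dsum_norm b.
Proof.
apply: dsum_norm_le => [|j]; first by rewrite addr_ge0 ?dsum_norm_ge0.
by rewrite (le_trans (cnorm_triangle _ _))// lerD ?cnorm_le_dsum_norm.
Qed.

Fact dsum_norm_mul a b : dsum_norm (a * b) <= dsum_norm a * dsum_norm b.
Proof.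
apply: dsum_norm_le => [|j]; first by rewrite mulr_ge0 ?dsum_norm_ge0.
by rewrite (le_trans (cnorm_mul _ _))// ler_pM ?cnorm_ge0 ?cnorm_le_dsum_norm.
Qed.

Fact dsum_norm_scal (c : R[i]) a :
  dsum_norm (scal (c : Cplx R) * a) = Normc.normc c * dsum_norm a.
Proof.
have cE j : cnorm ((scal (c : Cplx R) * a) j) = Normc.normc c * cnorm (a j).
  exact: cnorm_scal.
apply/le_anti/andP; split.
  apply: dsum_norm_le => [|j].
    by rewrite mulr_ge0 ?dsum_norm_ge0 ?normc_ge0.
  by rewrite cE ler_wpM2l ?normc_ge0 ?cnorm_le_dsum_norm.
have [->|c0] := eqVneq (Normc.normc c) 0; first by rewrite mul0r dsum_norm_ge0.
have c_gt0 : 0 < Normc.normc c by rewrite lt_def c0 normc_ge0.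
rewrite mulrC -ler_pdivlMr//; apply: dsum_norm_le => [|j].
  by rewrite divr_ge0 ?dsum_norm_ge0 ?normc_ge0.
by rewrite ler_pdivlMr// mulrC -cE cnorm_le_dsum_norm.
Qed.

Fact dsum_norm_star a : dsum_norm (star a * a) = dsum_norm a ^+ 2.
Proof.
have sE j : cnorm ((star a * a) j) = cnorm (a j) ^+ 2 by exact: cnorm_star.
apply/le_anti/andP; split.
  apply: dsum_norm_le => [|j]; first exact: sqr_ge0.
  by rewrite sE ler_sqr ?nnegrE ?cnorm_ge0 ?dsum_norm_ge0 ?cnorm_le_dsum_norm.
rewrite -[leRHS]sqr_sqrtr ?dsum_norm_ge0//.
rewrite ler_sqr ?nnegrE ?dsum_norm_ge0 ?sqrtr_ge0//; apply: dsum_norm_le => [|j].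
  exact: sqrtr_ge0.
rewrite -[leLHS]ger0_norm ?cnorm_ge0// -sqrtr_sqr ler_wsqrtr//.
by rewrite -sE cnorm_le_dsum_norm.
Qed.

Fact dsum_norm_complete (u : nat -> D) :
  (forall e : R, 0 < e -> exists N : nat, forall m n : nat,
     (N <= m)%N -> (N <= n)%N -> dsum_norm (u m - u n) < e) ->
  exists l, dsum_norm (u n - l) @[n --> \oo] --> (0 : R).
Proof.
move=> cu; have ex j : exists l, cnorm (u n j - l) @[n --> \oo] --> (0 : R).
  apply: cnorm_complete => e /cu[N Nu]; exists N => p n Np Nn.
  exact: le_lt_trans (cnorm_le_dsum_norm (u p - u n) j) (Nu _ _ Np Nn).
exists (fun j => projT1 (cid (ex j))); apply/cvgrPdist_lt => e e0.
have : \forall n \near \oo, forall j, cnorm (u n j - projT1 (cid (ex j))) < e.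
  apply: (@filter_forall _ 'I_m
    (fun j n => cnorm (u n j - projT1 (cid (ex j))) < e)) => j.
  have /cvgrPdist_lt/(_ e e0) := projT2 (cid (ex j)); apply: filterS => n.
  by rewrite sub0r normrN ger0_norm ?cnorm_ge0.
apply: filterS => n ne; rewrite sub0r normrN ger0_norm ?dsum_norm_ge0//.
by apply: bigmax_lt.
Qed.

Definition dsum_cstar : cstarAlg R :=
  CstarAlg dsum_norm_eq0 dsum_norm_triangle dsum_norm_scal dsum_norm_mul
    dsum_norm_star dsum_norm_complete.

End DirectSumAlgebra.

(** * Ranks and homotopies of matrix-valued projections *)

(** A full-rank factorisation [P = U V] satisfies [V U = 1], by cancelling in [U V U V = U V]; the
    trace of [U V] is that of [V U]. Ranks become traces, which are additive and easy to follow
    through diagonal maps. *)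
Lemma mxtrace_idem (F : fieldType) n (P : 'M[F]_n) :
  P *m P = P -> \tr P = (\rank P)%:R.
Proof.
move=> PP; have := mulmx_base P; have := col_base_full P.
have := row_base_free P; move: (col_base P) (row_base P) => U V Vf Uf UV.
rewrite -{1}UV mxtrace_mulC; suff -> : V *m U = 1%:M by rewrite mxtrace1.
apply: (row_free_inj Vf); apply: (row_full_inj Uf).
by rewrite mul1mx !mulmxA UV -mulmxA UV.
Qed.

(** The rows of [W] are an orthonormal basis of the row space of [P]. For [Q = W^* W] one has
    [P Q = P], whose adjoint is [Q P = P], while [W P = W] gives [Q P = Q]. The rank is a variable
    [r] so that two projections of equal rank get matrices with the same number of rows. *)
Lemma hermitian_idem_base (C : numClosedFieldType) n (P : 'M[C]_n) r :
  (map_mx Num.conj P)^T = P -> P *m P = P -> \rank P = r ->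
  exists W : 'M[C]_(r, n),
    W *m (map_mx Num.conj W)^T = 1%:M /\ (map_mx Num.conj W)^T *m W = P.
Proof.
move=> Ph PP <-; pose W := schmidt (row_base P); exists W.
have WW : W *m (map_mx Num.conj W)^T = 1%:M.
  by rewrite map_trmx; apply/unitarymxP/schmidt_unitarymx/rank_leq_row.
split=> //; set V := (map_mx _ W)^T.
have WP : (W :=: P)%MS.
  exact: eqmx_trans (eqmx_schmidt_free (row_base_free P)) (eq_row_base P).
have /submxP[X WE] : (W <= P)%MS by rewrite WP.
have /submxP[Y PE] : (P <= W)%MS by rewrite WP.
have h1 : W *m P = W by rewrite WE -mulmxA PP.
have h2 : P *m (V *m W) = P by rewrite {1}PE !mulmxA -(mulmxA Y) WW mulmx1 -PE.
have : (map_mx Num.conj (P *m (V *m W)))^T = P by rewrite h2.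
rewrite !map_mxM !trmx_mul Ph -/V -map_trmx trmxK.
rewrite (_ : map_mx _ (map_mx _ W) = W); last first.
  by apply/matrixP => i j; rewrite !mxE; exact: conjCK.
by rewrite -mulmxA h1.
Qed.

Section Flattening.
Variables (R : realType) (Y : topologicalType) (k : nat).
Local Notation C := (Cplx R).
Local Notation B := (cmx R Y k).

Definition flat_mx (y : Y) m n (M : 'M[B]_(m, n)) :
    'M[C]_(\sum_(a < m) k, \sum_(b < n) k) :=
  \mxblock_(a < m, b < n) M a b y.

Lemma cmx_sumE I (s : seq I) (P : pred I) (F : I -> B) y :
  (\sum_(i <- s | P i) F i) y = \sum_(i <- s | P i) F i y.
Proof. by elim/big_rec2: _ => [|i x z _ <-]. Qed.

Lemma flat_mxM y m n p (M : 'M[B]_(m, n)) (N : 'M[B]_(n, p)) :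
  flat_mx y (M *m N) = flat_mx y M *m flat_mx y N.
Proof.
rewrite /flat_mx mul_mxblock; apply: eq_mxblock => a b.
by rewrite mxE cmx_sumE.
Qed.

Lemma flat_mx_adj y m n (M : 'M[B]_(m, n)) :
  flat_mx y (adjmx M) = conj_trmx (flat_mx y M).
Proof.
have -> : flat_mx y (adjmx M) =
    (\mxblock_(a < m, b < n) map_mx Num.conj (M a b y))^T.
  by rewrite tr_mxblock; apply: eq_mxblock => a b; rewrite !mxE.
by rewrite /conj_trmx; congr (_^T); apply/matrixP => i j; rewrite !mxE.
Qed.

Lemma flat_mx_inj m n (M N : 'M[B]_(m, n)) :
  (forall y, flat_mx y M = flat_mx y N) -> M = N.
Proof.
move=> MN; apply/matrixP => a b; apply: cmxP => y.
have sub (L : 'M[B]_(m, n)) : L a b y = submxblock (flat_mx y L) a b.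
  by rewrite /flat_mx mxblockK.
by rewrite !sub MN.
Qed.

Lemma mxtrace_flat y m (M : 'M[B]_m) :
  \tr (flat_mx y M) = \sum_a \tr (M a a y : 'M[C]_k).
Proof. exact: mxtrace_mxblock. Qed.

Definition cmx_rank (p : matproj B) (y : Y) : nat := \rank (flat_mx y (mpval p)).

Lemma flat_projmx (p : matproj B) y :
  conj_trmx (flat_mx y p) = flat_mx y p /\
  flat_mx y p *m flat_mx y p = flat_mx y p.
Proof.
by have [p1 p2] := mpvalP p; rewrite -flat_mx_adj -flat_mxM p1 p2.
Qed.

Lemma cmx_rank_tr (p : matproj B) y :
  (cmx_rank p y)%:R = \sum_a \tr (mpval p a a y : 'M[C]_k).
Proof. by rewrite -mxtrace_flat mxtrace_idem// ; case: (flat_projmx p y). Qed.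

Lemma cmx_rank_le (p q : matproj B) (u : 'M[B]_(mpsize p, mpsize q))
    (v : 'M[B]_(mpsize q, mpsize p)) y :
  mpval p = u *m q *m v -> (cmx_rank p y <= cmx_rank q y)%N.
Proof.
rewrite /cmx_rank => ->; rewrite !flat_mxM.
exact: leq_trans (mxrankM_maxl _ _) (mxrankM_maxr _ _).
Qed.

Lemma cmx_rank_mvn (p q : matproj B) y :
  mvn_equivalent p q -> cmx_rank p y = cmx_rank q y.
Proof.
move=> [v [v1 v2]]; have [_ p2] := mpvalP p; have [_ q2] := mpvalP q.
apply/eqP; rewrite eqn_leq; apply/andP; split.
  apply: (@cmx_rank_le p q (adjmx v) v).
  by rewrite -v2 mulmxA v1 -mulmxA v1 p2.
apply: (@cmx_rank_le q p v (adjmx v)).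
by rewrite -v1 mulmxA v2 -mulmxA v2 q2.
Qed.

(** Write the two scalar projections as [W^* W] and [U^* U] with [W W^* = U U^* = 1]. Then [U^* W]
    is a partial isometry from the first to the second, and its blocks, taken as constant functions,
    form the required matrix. *)
Lemma mvn_const (p q : matproj B) (y0 : Y) :
  (forall a b y, mpval p a b y = mpval p a b y0) ->
  (forall a b y, mpval q a b y = mpval q a b y0) ->
  cmx_rank p y0 = cmx_rank q y0 -> mvn_equivalent p q.
Proof.
move=> pc qc pq.
have flat_c (M : matproj B) : (forall a b y, mpval M a b y = mpval M a b y0) ->
    forall y, flat_mx y M = flat_mx y0 M.
  by move=> Mc y; apply: eq_mxblock => a b.
have [ph pp] := flat_projmx p y0; have [qh qq] := flat_projmx q y0.
have [W [W1 W2]] := hermitian_idem_base ph pp pq.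
have [U [U1 U2]] := hermitian_idem_base qh qq erefl.
pose V := conj_trmx U *m W.
pose v : 'M[B]_(mpsize q, mpsize p) :=
  \matrix_(a, b) cmx_cst Y (submxblock V a b).
have vV y : flat_mx y v = V.
  rewrite -[RHS]submxblockK; apply: eq_mxblock => a b.
  by rewrite mxE.
exists v; split; apply: flat_mx_inj => y; rewrite flat_mxM flat_mx_adj vV.
  rewrite flat_c// -W2 conj_trmxM conj_trmxK mulmxA -(mulmxA _ U) [U *m _]U1.
  by rewrite mulmx1.
rewrite flat_c// -U2 conj_trmxM conj_trmxK mulmxA -(mulmxA _ W) [W *m _]W1.
by rewrite mulmx1.
Qed.

End Flattening.

Section MvnEquivalence.
Variables (C : numClosedFieldType) (A : starAlgType C).
Implicit Types p q r : matproj A.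

Lemma mvn_equivalent_sym p q : mvn_equivalent p q -> mvn_equivalent q p.
Proof. by move=> [v [v1 v2]]; exists (adjmx v); rewrite adjmxK. Qed.

Lemma mvn_equivalent_trans p q r :
  mvn_equivalent p q -> mvn_equivalent q r -> mvn_equivalent p r.
Proof. by rewrite -!mvn_classP => -> ->. Qed.

Lemma mvn_equivalent_refl p : mvn_equivalent p p.
Proof. exact/mvn_classP. Qed.

End MvnEquivalence.

(** * Homotopy invariance and projections over contractible spaces *)

Section Pullback.
Variables (R : realType) (Y Z : topologicalType) (k : nat) (h : Z -> Y).
Hypothesis hc : continuous h.
Local Notation B T := (cmx R T k).

Fact pull_fun_continuous (f : B Y) : continuous (f \o h).
Proof. by move=> z; apply: continuous_comp; [exact: hc|exact: cmx_continuous]. Qed.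

Definition pull_fun (f : B Y) : B Z := Cmx (@pull_fun_continuous f).

Fact pull_fun_zmod : zmod_morphism pull_fun.
Proof. by move=> f g; apply: cmxP. Qed.

Fact pull_fun_monoid : monoid_morphism pull_fun.
Proof. by split=> [|f g]; apply: cmxP. Qed.

HB.instance Definition _ :=
  GRing.isZmodMorphism.Build (B Y) (B Z) pull_fun pull_fun_zmod.
HB.instance Definition _ :=
  GRing.isMonoidMorphism.Build (B Y) (B Z) pull_fun pull_fun_monoid.

Fact pull_fun_scal (c : Cplx R) : pull_fun (scal c) = scal c.
Proof. exact: cmxP. Qed.

Fact pull_fun_star (f : B Y) : pull_fun (star f) = star (pull_fun f).
Proof. exact: cmxP. Qed.

Definition pull : starHom (B Y) (B Z) := StarHom pull_fun_scal pull_fun_star.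

End Pullback.

Section Homotopy.
Variables (R : realType) (Y Z : topologicalType) (k : nat).
Hypotheses (Zc : compact [set: Z]) (z0 : Z).
Variables (H : R * Z -> Y) (Hc : continuous H).

Fact slice_continuous (t : R) : continuous (fun z => H (t, z)).
Proof.
move=> z; have c : {for z, continuous (fun z : Z => (t, z))}.
  apply: (@cvg_pair _ _ _ (nbhs z) (nbhs t) (nbhs z) _ _ _ (fun=> t) id).
    exact: cvg_cst.
  exact: cvg_id.
by apply: (continuous_comp c); exact: Hc.
Qed.

Definition slice_pull (t : R) : starHom (cmx R Y k) (cmx R Z k) :=
  pull R k (slice_continuous (t := t)).

(** Compactness of [Z] upgrades joint continuity of [f (H (t, z))] to continuity in [t] for the
    supremum norm. *)
Lemma near_slice_pull (f : cmx R Y k) (t e : R) : 0 < e ->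
  \forall s \near t, cmx_norm (slice_pull t f - slice_pull s f) <= e.
Proof.
move=> e0.
have cov : near_covering [set: Z] by exact/compact_near_coveringP.
have h := cov R (nbhs t)
  (fun s z => opnorm (f (H (t, z)) - f (H (s, z))) <= e) _ _.
apply: filterS (h _ _) => [s hs|z _].
  by apply: cmx_norm_le => // z; exact: hs.
have e2 : 0 < e / 2 by rewrite divr_gt0.
have fH i j : {for (t, z), continuous (fun p => f (H p) i j)}.
  apply: (@continuous_comp _ _ _ H (fun y => f y i j)); first exact: Hc.
  exact: cmx_entry.
  have [[U V] /= [tU zV] UV] := @near_opnorm R _ k (fun p => f (H p)) (t, z) _ e2 fH.
  exists (V, U) => //= -[z' s] /= [z'V sU].
  have h1 := UV (t, z') (conj (nbhs_singleton tU) z'V).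
  have h2 := UV (s, z') (conj sU z'V).
  have -> : f (H (t, z')) - f (H (s, z')) = (f (H (t, z')) - f (H (t, z))) +
      (- 1)%:M *m (f (H (s, z')) - f (H (t, z))).
    by rewrite mul_scalar_mx scaleN1r opprB addrA subrK.
  rewrite (le_trans (opnormD _ _))// opnormZ normcN Normc.normc1 mul1r.
  by apply: le_trans (lerD (ltW h1) (ltW h2)) _; rewrite -splitr.
Qed.

Lemma near_slice_mvn (p : matproj (cmx R Y k)) (t : R) :
  \forall s \near t, mvn_equivalent (mpmap (slice_pull t) p) (mpmap (slice_pull s) p).
Proof.
pose m := mpsize p; pose d : R := 32^-1 / (m * m).+1%:R.
have d0 : 0 < d by rewrite divr_gt0// invr_gt0.
have : \forall s \near t, forall a b,
    cmx_norm (slice_pull t (mpval p a b) - slice_pull s (mpval p a b)) <= d.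
  apply: (@filter_forall R 'I_m (fun a (s : R) => forall b,
    cmx_norm (slice_pull t (mpval p a b) - slice_pull s (mpval p a b)) <= d)
    (nbhs t) _) => a.
  apply: (@filter_forall R 'I_m (fun b (s : R) =>
    cmx_norm (slice_pull t (mpval p a b) - slice_pull s (mpval p a b)) <= d)
    (nbhs t) _) => b.
  exact: near_slice_pull.
apply: filterS => s sd.
have := @close_projmx_mvn R (cmx_cstar R k Zc z0) m _ _
  (mpmap_subproof (slice_pull t) p) (mpmap_subproof (slice_pull s) p).
apply.
apply: (@le_trans _ _ (\sum_(a < m) \sum_(b < m) d)).
  apply: ler_sum => a _; apply: ler_sum => b _; rewrite !mxE; exact: sd.
rewrite !sumr_const !card_ord -mulrnA -[leLHS]mulr_natl mulrCA ler_piMr ?invr_ge0//.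
by rewrite ler_pdivrMr// mul1r ler_nat.
Qed.

(** The class of the pullback is locally constant in time, so the times equivalent to [s] form a
    nonempty open and closed subset of the connected real line. *)
Lemma slice_mvn (p : matproj (cmx R Y k)) (s t : R) :
  mvn_equivalent (mpmap (slice_pull s) p) (mpmap (slice_pull t) p).
Proof.
pose e a b := mvn_equivalent (mpmap (slice_pull a) p) (mpmap (slice_pull b) p).
have /connected_intervalP/(_ (e s)) cR : is_interval [set: R] by [].
suff eT : e s = setT by change (e s t); rewrite eT.
apply: cR.
- exists s; rewrite /e; exact: mvn_equivalent_refl.
- exists (e s); rewrite ?setTI// openE => a sa; have := near_slice_mvn p a.
  by apply: filterS => b; exact: mvn_equivalent_trans.
- exists (e s); rewrite ?setTI// -openC openE => a sa; have := near_slice_mvn p a.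
  apply: filterS => b ab sb; apply: sa.
  exact: mvn_equivalent_trans sb (mvn_equivalent_sym ab).
Qed.

End Homotopy.

Section Contractible.
Variable R : realType.

(** Time is clamped to the unit interval, which turns continuity within the strip into continuity on
    the whole product. *)
Lemma contractible_global (Y : topologicalType) : contractible R Y ->
  exists (x0 : Y) (H : R * Y -> Y),
    [/\ continuous H, forall x, H (0, x) = x & forall x, H (1, x) = x0].
Proof.
move=> [x0 [H [Hc H0 H1]]]; exists x0.
pose g (p : R * Y) := (Num.max 0 (Num.min p.1 1), p.2).
have gI p : 0 <= (g p).1 <= 1.
  by rewrite /= le_max lexx ge_max ler01 ge_min lexx orbT.
have gc : continuous g.
  move=> p; apply: (@cvg_pair _ _ _ (nbhs p) (nbhs (g p).1) (nbhs p.2) _ _ _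
    (fun p => (g p).1) snd); last exact: cvg_snd.
  apply: (@continuous_comp _ _ _ fst (fun t : R => Num.max 0 (Num.min t 1))).
    exact: cvg_fst.
  apply: (@continuous_max R R (cst 0) (idfun \min cst 1)); first exact: cvg_cst.
  by apply: (@continuous_min R R idfun (cst 1)); [exact: cvg_id|exact: cvg_cst].
exists (H \o g); split=> [p|x|x] /=.
- have /subspace_continuousP/(_ (g p) (gI p)) Hg := Hc.
  move=> U /Hg; rewrite /within/= => UH; have gU := gc p _ UH.
  by apply: (@filterS _ (nbhs p) _ _ _ _ gU) => q /(_ (gI q)).
- by rewrite /g /= min_l ?ler01// max_l.
- by rewrite /g /= min_l// max_r ?ler01.
Qed.

Lemma continuous_prod_topology (I : Type) (T : topologicalType)
    (X : I -> topologicalType) (f : T -> prod_topology X) :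
  (forall i, continuous (fun t => f t i)) -> continuous f.
Proof.
move=> fc t; apply/cvg_sup => i U /= [V [[W oW <-] Wt] VU].
apply: filterS VU _; apply: (fc i t W); exact: open_nbhs_nbhs.
Qed.

Lemma contractible_prod (I : eqType) (X : topologicalType) : contractible R X ->
  contractible R (prod_topology (fun _ : I => X)).
Proof.
move=> /contractible_global[x0 [H [Hc H0 H1]]].
exists (fun=> x0), (fun p a => H (p.1, p.2 a)); split=> [|x|x].
- apply: continuous_subspaceT; apply: continuous_prod_topology => a p.
  have c : {for p, continuous
      (fun p : R * prod_topology (fun _ : I => X) => (p.1, p.2 a))}.
    apply: (@cvg_pair _ _ _ (nbhs p) (nbhs p.1) (nbhs (p.2 a)) _ _ _
      fst (fun p => p.2 a)).
      exact: cvg_fst.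
    apply: (@continuous_comp _ (prod_topology (fun _ : I => X)) X snd
      (@proj I (fun=> X) a)); first exact: cvg_snd.
    exact: proj_continuous.
  by apply: (continuous_comp c); exact: Hc.
- by apply: functional_extensionality_dep => a; rewrite H0.
- by apply: functional_extensionality_dep => a; rewrite H1.
Qed.

Section ProjectionsOverContractible.
Variables (Y : topologicalType) (k : nat).
Hypotheses (Yc : compact [set: Y]) (Ycontr : contractible R Y).
Implicit Types p q : matproj (cmx R Y k).

(** The pullback of [p] at time [0] is [p] itself, and the one at time [1] factors through the point
    [x0]. *)
Lemma contractible_const p : exists (x0 : Y) (p0 : matproj (cmx R Y k)),
  (forall a b y, mpval p0 a b y = mpval p0 a b x0) /\ mvn_equivalent p p0.
Proof.
have [x0 [H [Hc H0 H1]]] := contractible_global Ycontr.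
exists x0, (mpmap (slice_pull k Hc 1) p); split.
  by move=> a b y; rewrite !mxE /= !H1.
apply: mvn_equivalent_trans (slice_mvn Yc x0 Hc p 0 1).
have [p1 p2] := mpvalP p; exists (mpval p); rewrite p1 p2; split=> //.
by apply/matrixP => a b; rewrite !mxE; apply: cmxP => y /=; rewrite H0.
Qed.

Lemma contractible_rank p y y' : cmx_rank p y = cmx_rank p y'.
Proof.
have [x0 [p0 [p0c pp0]]] := contractible_const p.
rewrite !(cmx_rank_mvn _ pp0) /cmx_rank; congr (\rank _).
by apply: eq_mxblock => a b; rewrite (p0c _ _ y) (p0c _ _ y').
Qed.

Lemma contractible_mvn p q y : cmx_rank p y = cmx_rank q y -> mvn_equivalent p q.
Proof.
have [x0 [p0 [p0c pp0]]] := contractible_const p.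
have [x1 [q0 [q0c qq0]]] := contractible_const q.
rewrite !(cmx_rank_mvn _ pp0, cmx_rank_mvn _ qq0) => pq.
apply: (mvn_equivalent_trans pp0); apply: mvn_equivalent_trans (mvn_equivalent_sym qq0).
apply: (mvn_const (y0 := y)) => // [a b z|a b z].
  by rewrite p0c (p0c _ _ y).
by rewrite q0c (q0c _ _ y).
Qed.

End ProjectionsOverContractible.
End Contractible.

(** * Projections over the stages *)

Section OperatorNormBlocks.
Variable R : realType.
Local Notation C := (Cplx R).

Lemma opnorm1 k : opnorm (1%:M : 'M[C]_k) <= 1.
Proof. by apply: opnorm_le => // v; rewrite mul1mx mul1r. Qed.

Lemma opnorm_unitary k (W M : 'M[C]_k) :
  W *m conj_trmx W = 1%:M -> conj_trmx W *m W = 1%:M ->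
  opnorm (W *m M *m conj_trmx W) <= opnorm M.
Proof.
have le1 (U : 'M[C]_k) : conj_trmx U *m U = 1%:M -> opnorm U <= 1.
  move=> U1; rewrite -(@ler_pXn2r _ 2)// ?nnegrE ?opnorm_ge0//.
  by rewrite -opnorm_conj_trmxM U1 expr1n opnorm1.
move=> W1 W2; apply: le_trans (opnormM _ _) _.
have W1' : opnorm (conj_trmx W) <= 1 by apply: le1; rewrite conj_trmxK.
apply: le_trans (ler_piMr (opnorm_ge0 _) W1') _.
exact: le_trans (opnormM _ _) (ler_piMl (opnorm_ge0 _) (le1 _ W2)).
Qed.

Lemma vnorm_mxcol p (p_ : 'I_p -> nat) (u : forall i, 'cV[C]_(p_ i)) :
  vnorm (\mxcol_i u i) ^+ 2 = \sum_i vnorm (u i) ^+ 2.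
Proof.
apply: (@complexI R); rewrite -conj_trmx_vnorm raddf_sum /=.
have -> : conj_trmx (\mxcol_i u i) = \mxrow_i conj_trmx (u i).
  rewrite /conj_trmx -tr_mxcol; congr (_^T); apply/matrixP => i j.
  by rewrite !mxE.
rewrite mul_mxrow_mxcol summxE; apply: eq_bigr => i _.
exact: conj_trmx_vnorm.
Qed.

Lemma opnorm_mxdiag p (p_ : 'I_p -> nat) (M : forall i, 'M[C]_(p_ i)) (c : R) :
  0 <= c -> (forall i, opnorm (M i) <= c) -> opnorm (\mxdiag_i M i) <= c.
Proof.
move=> c0 Mc; apply: opnorm_le => // v.
rewrite -(@ler_pXn2r _ 2)// ?nnegrE ?mulr_ge0 ?vnorm_ge0//.
rewrite -(submxcolK v) mul_mxdiag_mxcol exprMn !vnorm_mxcol mulr_sumr.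
apply: ler_sum => i _; rewrite -exprMn.
rewrite ler_pXn2r// ?nnegrE ?mulr_ge0 ?vnorm_ge0//.
by rewrite (le_trans (vnorm_mulmx _ _))// ler_wpM2r ?vnorm_ge0.
Qed.

End OperatorNormBlocks.

(** * Norm and trace of diagonal maps *)

Section DiagonalMaps.
Variables (R : realType) (m : nat) (Y : topologicalType) (l : nat).
Variables (Z : 'I_m -> topologicalType) (k : 'I_m -> nat).
Local Notation C := (Cplx R).
Variables (t : 'I_m -> nat) (h : forall j, 'I_(t j) -> Y -> Z j)
  (e : (\sum_j \sum_(i < t j) k j)%N = l) (w : cmx R Y l).
Hypotheses (w1 : w * star w = 1) (w2 : star w * w = 1).
Local Notation diag f y :=
  (w y *m castmx (e, e) (diag_blocks h f y) *m star w y).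

Let w1y y : w y *m conj_trmx (w y) = 1%:M.
Proof. exact: (congr1 (fun f : cmx R Y l => f y) w1). Qed.

Let w2y y : conj_trmx (w y) *m w y = 1%:M.
Proof. exact: (congr1 (fun f : cmx R Y l => f y) w2). Qed.

Lemma opnorm_castmx n n' (E : n = n') (M : 'M[C]_n) :
  opnorm (castmx (E, E) M) = opnorm M.
Proof. by case: n' / E; rewrite castmx_id. Qed.

Lemma mxtrace_castmx n n' (E : n = n') (M : 'M[C]_n) :
  \tr (castmx (E, E) M) = \tr M.
Proof. by case: n' / E; rewrite castmx_id. Qed.

Lemma opnorm_diag (f : dsum (fun j => cmx R (Z j) (k j))) y (c : R) : 0 <= c ->
  (forall j z, opnorm (f j z) <= c) -> opnorm (diag f y) <= c.
Proof.
move=> c0 fc; apply: le_trans (opnorm_unitary _ (w1y y) (w2y y)) _.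
rewrite opnorm_castmx; apply: opnorm_mxdiag => // j.
exact: opnorm_mxdiag.
Qed.

Lemma mxtrace_diag_blocks (f : dsum (fun j => cmx R (Z j) (k j))) y :
  \tr (diag f y) = \sum_j \sum_(i < t j) \tr (f j (h i y)).
Proof.
rewrite mxtrace_mulC mulmxA [star w y *m _]w2y mul1mx mxtrace_castmx.
by rewrite mxtrace_mxdiag; apply: eq_bigr => j _; rewrite mxtrace_mxdiag.
Qed.

End DiagonalMaps.

Section DirectSumProjection.
Variables (C : numClosedFieldType) (I : finType) (B : I -> starAlgType C) (i : I).

Definition dsum_proj_fun (a : dsum B) : B i := a i.

Fact dsum_proj_zmod : zmod_morphism dsum_proj_fun. Proof. by []. Qed.
Fact dsum_proj_monoid : monoid_morphism dsum_proj_fun. Proof. by []. Qed.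
HB.instance Definition _ :=
  GRing.isZmodMorphism.Build (dsum B) (B i) dsum_proj_fun dsum_proj_zmod.
HB.instance Definition _ :=
  GRing.isMonoidMorphism.Build (dsum B) (B i) dsum_proj_fun dsum_proj_monoid.

Definition dsum_proj : starHom (dsum B) (B i) :=
  @StarHom _ _ _ dsum_proj_fun (fun=> erefl) (fun=> erefl).

End DirectSumProjection.

(** The partial isometries of the components all have the size prescribed by [p] and [q], so they
    assemble into one matrix over the direct sum. *)
Lemma dsum_mvn (C : numClosedFieldType) (I : finType) (B : I -> starAlgType C)
    (p q : matproj (dsum B)) :
  (forall i, mvn_equivalent (mpmap (dsum_proj B i) p) (mpmap (dsum_proj B i) q)) ->
  mvn_equivalent p q.
Proof.
move=> /(_ _)/cid-v; pose V : 'M[dsum B]_(mpsize q, mpsize p) :=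
  \matrix_(a, b) (fun i => projT1 (v i) a b).
have VE i : map_mx (dsum_proj B i) V = projT1 (v i).
  by apply/matrixP => a b; rewrite !mxE.
have inj n n' (M N : 'M[dsum B]_(n, n')) :
    (forall i, map_mx (dsum_proj B i) M = map_mx (dsum_proj B i) N) -> M = N.
  move=> MN; apply/matrixP => a b; apply: dsumP => i.
  by have /matrixP/(_ a b) := MN i; rewrite !mxE.
exists V; split; apply: inj => i; rewrite map_mxM -adjmx_map VE.
  exact: (projT2 (v i)).1.
exact: (projT2 (v i)).2.
Qed.

(** * Ranks classify projections over a stage *)

Section StageProjections.
Variables (R : realType) (m : nat) (S : sys_data R m).
Hypothesis contr : forall j, contractible R (sp S j).
Local Notation C := (Cplx R).

Lemma space_compact j n : compact [set: Defs.space S j n].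
Proof.
have := @tychonoff 'I_(ss S j n) (fun=> sp S j) (fun=> setT)
  (fun=> @sp_compact R m S j).
by congr compact; apply/seteqP; split.
Qed.

Lemma space_contractible j n : contractible R (Defs.space S j n).
Proof. exact: contractible_prod. Qed.

Definition base_point j n : Defs.space S j n := fun=> projT1 (cid (contr j)).
Arguments base_point j n : clear implicits.

(** Its underlying algebra and its norm are [stage S n] and [stage_norm] up to conversion, so a type
    annotation suffices to apply the C*-algebra lemmas to a stage. Contractibility supplies the
    points that make the supremum norms well defined. *)
Definition stage_cstar n : cstarAlg R :=
  dsum_cstar (fun j => cmx_cstar R (rr S j n) (@space_compact j n) (base_point j n)).

Lemma rr_gt0 j n : (0 < rr S j n)%N.
Proof.
elim: n => [|n IHn]; first exact: rr0_gt0.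
rewrite rrS (bigD1 j)//= ltn_addr// muln_gt0 IHn andbT.
exact: leq_trans (dd_gt0 S j (ltn0Sn n)) (dd_le_mu S j (ltn0Sn n)).
Qed.

Definition stage_rank n (p : matproj (stage S n)) j : nat :=
  mprank p (base_point j n).

Lemma mprankE n (p : matproj (stage S n)) j (y : Defs.space S j n) :
  mprank p y = cmx_rank (mpmap (dsum_proj _ j) p) y.
Proof. by congr (\rank _); apply: eq_mxblock => a b; rewrite mxE. Qed.

Lemma mprank_const n (p : matproj (stage S n)) j (y : Defs.space S j n) :
  mprank p y = stage_rank p j.
Proof.
rewrite /stage_rank !mprankE; apply: contractible_rank.
  exact: space_compact.
exact: space_contractible.
Qed.

Lemma stage_rank_tr n (p : matproj (stage S n)) j (y : Defs.space S j n) :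
  (stage_rank p j)%:R = \sum_a \tr (mpval p a a j y) :> C.
Proof.
rewrite -(mprank_const p y) mprankE cmx_rank_tr.
by apply: eq_bigr => a _; rewrite mxE.
Qed.

Lemma stage_mvn n (p q : matproj (stage S n)) :
  stage_rank p =1 stage_rank q -> mvn_equivalent p q.
Proof.
move=> pq; apply: dsum_mvn => j.
apply: (contractible_mvn (@space_compact j n) (space_contractible j n)
  (y := base_point j n)).
by rewrite -!mprankE; exact: pq.
Qed.

Lemma stage_rank_mpsum n (p q : matproj (stage S n)) j :
  stage_rank (mpsum p q) j = (stage_rank p j + stage_rank q j)%N.
Proof.
apply/eqP; rewrite -(eqr_nat C) natrD !(stage_rank_tr _ (base_point j n)).
rewrite big_split_ord /=; apply/eqP.
by congr (_ + _); apply: eq_bigr => i _; rewrite ?block_mxEul ?block_mxEdr.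
Qed.

Lemma stage_rank_le n (p q : matproj (stage S n))
    (u : 'M[stage S n]_(mpsize p, mpsize q))
    (v : 'M[stage S n]_(mpsize q, mpsize p)) j :
  mpval p = u *m q *m v -> (stage_rank p j <= stage_rank q j)%N.
Proof.
move=> puv; rewrite /stage_rank !mprankE.
apply: (@cmx_rank_le _ _ _ (mpmap (dsum_proj _ j) p) (mpmap (dsum_proj _ j) q)
  (map_mx (dsum_proj _ j) u) (map_mx (dsum_proj _ j) v)).
by rewrite /= -!map_mxM -puv.
Qed.

(** Constant projections of rank one in a single summand are added up; such projections exist
    because the matrix sizes are positive. *)
Lemma stage_rank_ex n (v : 'I_m -> nat) :
  exists p : matproj (stage S n), stage_rank p =1 v.
Proof.
have ex1 i : exists p : matproj (stage S n), forall j, stage_rank p j = (i == j).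
  (* The boolean is read as the rank, [1] in summand [i] and [0] elsewhere. *)
  pose E j : 'M[C]_(rr S j n) := pid_mx (i == j).
  have EE j : E j *m E j = E j.
    by rewrite /E mul_pid_mx !minnn (minn_idPr _)//; case: (i == j) => //; exact: rr_gt0.
  have Eh j : (map_mx Num.conj (E j))^T = E j.
    by rewrite /E map_pid_mx tr_pid_mx.
  pose P : 'M[stage S n]_1 := const_mx (fun j => cmx_cst (Defs.space S j n) (E j)).
  have PP : projmx P.
    split; apply/matrixP => a b; rewrite !mxE ?big_ord1 ?mxE; apply: dsumP => j.
      by apply: cmxP => y; exact: Eh.
    by apply: cmxP => y; exact: EE.
  exists (MatProj PP) => j; apply/eqP; rewrite -(eqr_nat C).
  rewrite (stage_rank_tr _ (base_point j n)) /= big_ord1 mxE mxtrace_idem ?EE//.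
  by rewrite rank_pid_mx//; case: (i == j) => //; exact: rr_gt0.
have [p0 p0E] : exists p : matproj (stage S n), forall j, stage_rank p j = 0%N.
  exists (mp0 _) => j; apply/eqP; rewrite -(eqr_nat C).
  by rewrite (stage_rank_tr _ (base_point j n)) big_ord0.
have exk i k : exists p : matproj (stage S n),
    forall j, stage_rank p j = (k * (i == j))%N.
  elim: k => [|k [p pE]]; first by exists p0.
  have [e eE] := ex1 i; exists (mpsum e p) => j.
  by rewrite stage_rank_mpsum eE pE mulSn.
have exs (s : seq 'I_m) : exists p : matproj (stage S n), forall j,
    stage_rank p j = (\sum_(i <- s) v i * (i == j))%N.
  elim: s => [|i s [p pE]]; first by exists p0 => j; rewrite big_nil.
  have [e eE] := exk i (v i); exists (mpsum e p) => j.
  by rewrite stage_rank_mpsum eE pE big_cons.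
have [p pE] := exs (enum 'I_m); exists p => j; rewrite pE big_enum (bigD1 j)//=.
by rewrite eqxx muln1 big1 ?addn0// => i /negbTE ->; rewrite muln0.
Qed.

End StageProjections.
Arguments base_point {R m S} contr j n : rename.

Lemma dsum_inM (C : numClosedFieldType) (I : finType) (B : I -> starAlgType C)
    (i : I) (x y : B i) : dsum_in x * dsum_in y = dsum_in (x * y) :> dsum B.
Proof.
apply: dsumP => j; change (dsum_in x j * dsum_in y j = dsum_in (x * y) j).
rewrite /dsum_in; have [<-|ij] := eqVneq i j; first by rewrite !dfwithin.
by rewrite !dfwithout// mul0r.
Qed.

Section SystemMaps.
Variables (R : realType) (m : nat) (S : system R m).
Hypotheses (contr : forall j, contractible R (sp S j)) (dg : sys_diagonal S).
Local Notation C := (Cplx R).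
Local Notation stage_rank := (stage_rank contr).

(** This is read off from the diagonal form: evaluating at points, forming block diagonals and
    conjugating by a unitary do not increase the norm. *)
Lemma sys_map_contractive n (f : stage S n) :
  stage_norm (sys_map S n f) <= stage_norm f.
Proof.
have f0 : 0 <= stage_norm f := dsum_norm_ge0 (f : stage_cstar contr n).
have := @dsum_norm_le R m _ (sys_map S n f : stage_cstar contr n.+1) _ f0.
apply=> j.
apply: cmx_norm_le => [||y]; [exact: space_compact|exact: base_point|].
have [t [h [e [w [_ w1 w2 ->]]]]] := dg n j.
apply: opnorm_diag => // i z.
apply: le_trans (cnorm_le_dsum_norm (f : stage_cstar contr n) i).
by apply: opnorm_le_cmx_norm; [exact: space_compact|exact: base_point].
Qed.

(** At a point [y] the trace of the image is the sum of the traces of [p] at the points [h j i y].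
    Each of them is the rank of [p] in summand [j], wherever the point lies. *)
Lemma sys_map_rank n (p : matproj (stage S n)) k :
  stage_rank (mpmap (sys_map S n) p) k =
  (\sum_j mu S k j n.+1 * stage_rank p j)%N.
Proof.
pose y := base_point contr k n.+1.
have [t [h [e [w [hc w1 w2 psiE]]]]] := dg n k.
have trE (f : stage S n) : \tr (sys_map S n f k y : 'M[C]_(rr S k n.+1)) =
    \sum_j \sum_(i < t j) \tr (f j (h j i y)).
  by rewrite psiE; exact: mxtrace_diag_blocks.
(* The diagonal form leaves the number of blocks open. The image of the unit of summand [j] is
   idempotent, so its trace [t j * rr S j n] equals its rank, which [sys_rank] prescribes. *)
have tE j : t j = mu S k j n.+1.
  apply/eqP; rewrite -(eqn_pmul2r (@rr_gt0 _ _ S j n)) -(eqr_nat C).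
  rewrite -(sys_rank (s:=S) j y) -mxtrace_idem; last first.
    have := dsum_inM (B := fun j => cmx R (Defs.space S j n) (rr S j n))
      (1 : cmx R (Defs.space S j n) (rr S j n)) 1.
    rewrite mul1r => e1; rewrite /component -[in RHS]e1 rmorphM.
    by [].
  rewrite /component trE (bigD1 j)//= /dsum_in dfwithin.
  under eq_bigr => i _ do rewrite mxtrace1.
  rewrite sumr_const card_ord big1 ?addr0 => [|i ij].
    by rewrite mulnC natrM mulr_natr.
  by apply: big1 => l _; rewrite dfwithout 1?eq_sym// mxtrace0.
apply/eqP; rewrite -(eqr_nat C) (stage_rank_tr _ _ y) /=.
under eq_bigr => a _ do rewrite mxE trE.
rewrite exchange_big natr_sum; apply/eqP/eq_bigr => j _.
rewrite exchange_big natrM /=.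
under eq_bigr => i _ do rewrite -(stage_rank_tr contr p (h j i y)).
by rewrite sumr_const card_ord tE mulr_natl.
Qed.

End SystemMaps.

(** * Projections over the direct limit *)

Section StarHomComposition.
Variables (C : numClosedFieldType) (A B D : starAlgType C).

Definition starHom_id : starHom A A :=
  @StarHom C A A idfun (fun=> erefl) (fun=> erefl).

Fact starHom_comp_scal (g : starHom B D) (f : starHom A B) k :
  (g \o f) (scal k) = scal k.
Proof. by rewrite /= !starHom_scal. Qed.

Fact starHom_comp_star (g : starHom B D) (f : starHom A B) a :
  (g \o f) (star a) = star ((g \o f) a).
Proof. by rewrite /= !starHom_star. Qed.

Definition starHom_comp (g : starHom B D) (f : starHom A B) : starHom A D :=
  @StarHom C A D (g \o f) (starHom_comp_scal g f) (starHom_comp_star g f).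

End StarHomComposition.

Lemma matproj_eq (C : numClosedFieldType) (A : starAlgType C) n (M N : 'M[A]_n)
    (Mp : projmx M) (Np : projmx N) : M = N -> MatProj Mp = MatProj Np.
Proof. by move=> e; case: N / e Np => Np; congr MatProj; exact: Prop_irrelevance. Qed.

Section NormEstimates.
Variables (R : realType) (A : cstarAlg R).

Lemma mnorm_star_mul m n (x v : 'M[A]_(m, n)) :
  mnorm (adjmx x *m x - adjmx v *m v) <= (mnorm x + mnorm v) * mnorm (x - v).
Proof.
have -> : adjmx x *m x - adjmx v *m v = adjmx x *m (x - v) + adjmx (x - v) *m v.
  by rewrite adjmxD adjmxN mulmxBr mulmxBl addrA subrK.
have := mnormD (adjmx x *m (x - v)) (adjmx (x - v) *m v).
have := mnormM (adjmx x) (x - v); have := mnormM (adjmx (x - v)) v.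
by rewrite !mnorm_adj; nra.
Qed.

Lemma mnorm_le_add m n (x v : 'M[A]_(m, n)) : mnorm x <= mnorm v + mnorm (x - v).
Proof. by have := mnormD v (x - v); rewrite addrC subrK. Qed.

Lemma mnorm_le_entries m n (M : 'M[A]_(m, n)) (e : R) : 0 < e ->
  (forall i j, cnorm (M i j) < e / (m * n).+1%:R) -> mnorm M < e.
Proof.
move=> e0 Me; apply: (@le_lt_trans _ _ (\sum_(i < m) \sum_(j < n) e / (m * n).+1%:R)).
  by do 2!apply: ler_sum => ? _; exact: ltW.
rewrite !sumr_const !card_ord -mulrnA -[ltLHS]mulr_natl mulnC mulrCA gtr_pMr//.
by rewrite ltr_pdivrMr// mul1r ltr_nat mulnC.
Qed.

End NormEstimates.

Section DirectLimit.
Variables (R : realType) (m : nat) (S : system R m).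
Hypotheses (contr : forall j, contractible R (sp S j)) (dg : sys_diagonal S).
Variables (A : cstarAlg R) (phioo : forall n, starHom (stage S n) A).
Hypothesis hA : sys_limit phioo.
Local Notation stage_rank := (stage_rank contr).
Local Notation st := (stage_cstar contr).

(** [connecting] is only a function; packaged as a [starHom] it acts on projections. *)
Fixpoint conn n k : starHom (stage S n) (stage S (k + n)) :=
  match k with
  | 0 => starHom_id _
  | k'.+1 => starHom_comp (sys_map S (k' + n)) (conn n k')
  end.

Lemma connE n k (b : stage S n) : conn n k b = connecting (sys_map S) k b.
Proof. by elim: k => //= k ->. Qed.

Lemma phioo_conn n k (b : stage S n) : phioo (k + n)%N (conn n k b) = phioo n b.
Proof. by elim: k => //= k <-; rewrite (dl_compat hA). Qed.

Lemma conn_norm n (b : stage S n) :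
  stage_norm (conn n k b) @[k --> \oo] --> cnorm (phioo n b).
Proof.
rewrite (_ : (fun k => _) = fun k => stage_norm (connecting (sys_map S) k b)).
  exact: (dl_norm hA).
by apply/funext => k; rewrite connE.
Qed.

Lemma phioo_contractive n (b : stage S n) : cnorm (phioo n b) <= stage_norm b.
Proof.
apply: (ler_cvg_to (@conn_norm n b) (cvg_cst (stage_norm b))).
apply: nearW => k.
by elim: k => //= k IHk; apply: le_trans (sys_map_contractive contr dg _) IHk.
Qed.

Lemma mnorm_phioo n a b (M : 'M[stage S n]_(a, b)) :
  mnorm (map_mx (phioo n) M) <= mnorm (M : 'M[st n]_(a, b)).
Proof. by do 2!apply: ler_sum => ? _; rewrite mxE; exact: phioo_contractive. Qed.

(** The sum over the entries commutes with the limit that defines the norm of [A]. The inequality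
    must be strict to pass back to the stages. *)
Lemma mnorm_conn n a b (M : 'M[stage S n]_(a, b)) (e : R) :
  mnorm (map_mx (phioo n) M) < e ->
  \forall k \near \oo, mnorm (map_mx (conn n k) M : 'M[st (k + n)]_(a, b)) < e.
Proof.
move=> Me; suff h : mnorm (map_mx (conn n k) M : 'M[st (k + n)]_(a, b)) @[k --> \oo]
    --> mnorm (map_mx (phioo n) M) by apply: cvgr_lt h _ Me.
apply: cvg_big => [|i _]; first exact: add_continuous.
apply: cvg_big => [|j _]; first exact: add_continuous.
rewrite mxE; have := @conn_norm n (M i j); apply: cvg_trans.
by apply: near_eq_cvg; apply: nearW => k; rewrite mxE.
Qed.

(** The finitely many entries are approximated separately and moved to a common stage. Its index has
    the form [k + n0] so that projections given at stage [n0] can be carried there by [conn]. *)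
Lemma phioo_approx n0 a b (M : 'M[A]_(a, b)) (e : R) : 0 < e ->
  exists k (N : 'M[stage S (k + n0)]_(a, b)),
    mnorm (map_mx (phioo (k + n0)%N) N - M) < e.
Proof.
move=> e0; pose d := e / (a * b).+1%:R; have d0 : 0 < d by rewrite divr_gt0.
have /choice[f fM] (ij : 'I_a * 'I_b) : exists nb : {n & stage S n},
    cnorm (phioo (tag nb) (tagged nb) - M ij.1 ij.2) < d.
  have [n [x xM]] := dl_dense hA (M ij.1 ij.2) d0.
  by exists (Tagged (stage S) x); rewrite cnormB.
pose n := (n0 + \max_ij tag (f ij))%N.
have lift n1 n2 : (n1 <= n2)%N -> forall x : stage S n1,
    exists y : stage S n2, phioo n2 y = phioo n1 x.
  by move=> /subnK <- x; exists (conn n1 (n2 - n1) x); exact: phioo_conn.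
have /choice[g gE] (ij : 'I_a * 'I_b) : exists y : stage S n,
    phioo n y = phioo (tag (f ij)) (tagged (f ij)).
  apply: lift; apply: leq_trans (leq_addl _ _).
  exact: (leq_bigmax (F := fun ij => tag (f ij)) ij).
suff : exists N : 'M[stage S n]_(a, b), mnorm (map_mx (phioo n) N - M) < e.
  have n0n : (n0 <= n)%N by exact: leq_addr.
  by move=> h; exists (n - n0)%N; rewrite subnK.
exists (\matrix_(i, j) g (i, j)); apply: mnorm_le_entries => // i j.
by rewrite !mxE gE; exact: (fM (i, j)).
Qed.

(* For [d = p - u^* u] and [w^2 = (1 - d)^-1] one has [p = p u^* q (u w^2)]. *)
Lemma stage_rank_close n (p q : matproj (stage S n))
    (u : 'M[stage S n]_(mpsize q, mpsize p)) j :
  q *m u = u -> mnorm (mpval p - adjmx u *m u : 'M[st n]_(mpsize p)) <= 32^-1 ->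
  (stage_rank p j <= stage_rank q j)%N.
Proof.
move=> qu; set d := _ - _ => d_le; have [p1 p2] := mpvalP p.
have d_adj : adjmx d = d.
  rewrite (adjmxD (A := st n)) (adjmxN (A := st n)) p1; congr (_ - _).
  by rewrite adjmxM adjmxK.
have [w [_ w_comm w2]] := ex_invsqrt (A := st n) d_adj d_le.
have wd : GRing.comm (1 - d) (w * w).
  have /commr_sym : GRing.comm w d by apply: w_comm.
  by move=> dw; apply/commr_sym/commrB; [exact: commr1|apply/commr_sym/commrM].
apply: (@stage_rank_le _ _ _ _ _ p q (p *m adjmx u) (u *m (w *m w))).
rewrite -[LHS]mulmx1 -[X in _ *m X]w2 -wd !mulmxE mulrA mulrBr mulr1.
rewrite -!mulmxE mulmxBr p2 subKr -!mulmxA.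
by rewrite (mulmxA q) qu.
Qed.

Lemma phioo_mvn_rank n (p q : matproj (stage S n)) :
  mvn_equivalent (mpmap (phioo n) p) (mpmap (phioo n) q) ->
  exists k l, forall j,
    stage_rank (mpmap (conn (l + n) k) (mpmap (conn n l) p)) j =
    stage_rank (mpmap (conn (l + n) k) (mpmap (conn n l) q)) j.
Proof.
move=> [v' [v'1 v'2]].
have [Ph PP] := mpvalP (mpmap (phioo n) p); have [_ QQ] := mpvalP (mpmap (phioo n) q).
set P := mpval (mpmap _ p) in v'1 Ph PP; set Q := mpval (mpmap _ q) in v'2 QQ.
(* unlike [v'], the partial isometry [v] satisfies [Q v P = v] by construction *)
pose v := v' *m P.
have v1 : adjmx v *m v = P by rewrite adjmxM Ph mulmxA -(mulmxA P) v'1 PP PP.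
have v2 : v *m adjmx v = Q.
  by rewrite adjmxM Ph mulmxA -(mulmxA v') PP -v'1 !mulmxA v'2 -mulmxA v'2 QQ.
have vE : Q *m v *m P = v.
  by rewrite -v'2 /v -!mulmxA PP (mulmxA (adjmx v')) v'1 PP.
have v0 := mnorm_ge0 v.
have K0 : 0 < 2 * mnorm v + 1 by lra.
have PQ0 : 0 <= mnorm Q * mnorm P by rewrite mulr_ge0 ?mnorm_ge0.
(* If [x] is within [e <= 1] of [v], then [x^* x] is within [(2 |v| + 1) e = 33^-1] of [v^* v]. This
   is strictly below the threshold [32^-1], so the estimate descends to a stage. *)
pose e := 33^-1 / (2 * mnorm v + 1).
have e0 : 0 < e by rewrite divr_gt0 ?invr_gt0.
pose d := e / (mnorm Q * mnorm P + 1).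
have d0 : 0 < d by rewrite divr_gt0// ltr_wpDl.
have [l [u0 u0v]] := phioo_approx n v d0.
pose p1 := mpmap (conn n l) p; pose q1 := mpmap (conn n l) q.
(* Compressing [u0] makes [q1 u = u] and [u p1 = u] exact at this and all later stages. In the limit
   it costs the factor [|Q| |P|], which the choice of [d] absorbs. *)
pose u : 'M[stage S (l + n)]_(mpsize q, mpsize p) := q1 *m u0 *m p1.
have p1E : map_mx (phioo (l + n)%N) p1 = P.
  by apply/matrixP => i j; rewrite !mxE phioo_conn.
have q1E : map_mx (phioo (l + n)%N) q1 = Q.
  by apply/matrixP => i j; rewrite !mxE phioo_conn.
pose x := map_mx (phioo (l + n)%N) u.
have xv : mnorm (x - v) <= e.
  rewrite -vE /x /u !map_mxM p1E q1E -mulmxBl -mulmxBr.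
  move: u0v; set y := _ - v => /ltW yd.
  have dE : d * (mnorm Q * mnorm P + 1) = e by rewrite divfK// gt_eqF// ltr_wpDl.
  apply: le_trans (mnormM _ _) _.
  apply: le_trans (ler_wpM2r (mnorm_ge0 P) (mnormM Q y)) _.
  have := ler_wpM2l PQ0 yd; rewrite mulrAC; move: dE; rewrite mulrDr mulr1 mulrC; lra.
have eE : e * (2 * mnorm v + 1) = 33^-1 by rewrite divfK// gt_eqF.
have e_le1 : e <= 1 by have := mulr_ge0 (ltW e0) v0; lra.
have x_le : mnorm x <= mnorm v + e by have := mnorm_le_add x v; lra.
have xv_le : (mnorm x + mnorm v) * mnorm (x - v) <= 33^-1.
  by rewrite -eE mulrC ler_pM ?mnorm_ge0 ?addr_ge0 ?mnorm_ge0//; lra.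
have h1 : mnorm (map_mx (phioo (l + n)%N) (mpval p1 - adjmx u *m u)) < 32^-1.
  rewrite map_mxB map_mxM -adjmx_map p1E -v1 mnormB.
  by apply: le_lt_trans (mnorm_star_mul x v) _; lra.
have h2 : mnorm (map_mx (phioo (l + n)%N)
    (mpval q1 - adjmx (adjmx u) *m adjmx u)) < 32^-1.
  rewrite map_mxB map_mxM -!adjmx_map q1E -v2 mnormB.
  rewrite -{1}(adjmxK v); apply: le_lt_trans (mnorm_star_mul (adjmx x) (adjmx v)) _.
  by rewrite -adjmxN -adjmxD !mnorm_adj; lra.
have [k _ /(_ k (leqnn k))[k1 k2]] := filterI (mnorm_conn h1) (mnorm_conn h2).
exists k, l => j; apply/eqP; rewrite eqn_leq; apply/andP; split.
- apply: (@stage_rank_close _ (mpmap (conn (l + n) k) p1) (mpmap (conn (l + n) k) q1)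
    (map_mx (conn (l + n) k) u)).
    have [_ q1q1] := mpvalP q1.
    by rewrite /= -map_mxM /u !mulmxA q1q1.
  by rewrite /= adjmx_map -map_mxM -map_mxB ltW.
- apply: (@stage_rank_close _ (mpmap (conn (l + n) k) q1) (mpmap (conn (l + n) k) p1)
    (map_mx (conn (l + n) k) (adjmx u))).
    have [p1h p1p1] := mpvalP p1.
    by rewrite /= -map_mxM /u !adjmxM p1h !mulmxA p1p1.
  by rewrite /= adjmx_map -map_mxM -map_mxB ltW.
Qed.

Lemma phioo_proj_approx (P : matproj A) :
  exists n (p : matproj (stage S n)), mvn_equivalent P (mpmap (phioo n) p).
Proof.
case: P => s P Pp; have [P1 P2] := Pp.
pose c := mnorm P; have c0 : 0 <= c := mnorm_ge0 _.
(* The constants are chosen backwards. The distance [d] from [a0] to [P] gives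
   [|b - P| <= (2 c + 2) d = e]; this gives [|b - b^2| <= (2 c + 2) e < tau]; and a defect of at
   most [tau] for an element of norm at most [c + 2] moves the corrected projection by at most
   [(2 c + 5) (2 tau) = 64^-1]. Finally [64^-1 + e <= 32^-1]. *)
pose tau : R := 128^-1 / (2 * c + 5).
have tau_gt0 : 0 < tau by rewrite divr_gt0 ?invr_gt0//; lra.
have tauE : tau * (2 * c + 5) = 128^-1 by rewrite divfK// gt_eqF//; lra.
pose e := tau / (2 * c + 3).
have e_gt0 : 0 < e by rewrite divr_gt0//; lra.
have eE : e * (2 * c + 3) = tau by rewrite divfK// gt_eqF//; lra.
pose d := e / (2 * c + 2).
have d_gt0 : 0 < d by rewrite divr_gt0//; lra.
have dE : d * (2 * c + 2) = e by rewrite divfK// gt_eqF//; lra.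
have tau_lt : tau <= 640^-1 by have := mulr_ge0 (ltW tau_gt0) c0; lra.
have e_lt : e <= 640^-1 by have := mulr_ge0 (ltW e_gt0) c0; lra.
have tau32 : tau <= 32^-1 by lra.
have e64 : 64^-1 + e <= 32^-1 by lra.
have tau2 : (2 * c + 5) * (2 * tau) = 64^-1 by lra.
have aux (x y : R) : 0 <= x -> x <= c + 2 -> 0 <= y -> y <= tau ->
    (2 * x + 1) * (2 * y) <= 64^-1.
  by move=> x0 xc y0 yt; rewrite -tau2 ler_pM ?addr_ge0 ?mulr_ge0//; lra.
have d_lt : d <= 1 by have := mulr_ge0 (ltW d_gt0) c0; lra.
have [l [a0 a0P]] := phioo_approx 0 P d_gt0.
move: (l + 0)%N a0 a0P => n a0 a0P {l}.
(* The approximant [a0] need not be self-adjoint. The product [a0^* a0] is self-adjoint already at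
   the stage, and it stays close to [P^* P = P]. *)
pose a := adjmx a0 *m a0; pose b := map_mx (phioo n) a.
have bP : mnorm (b - P) <= e.
  rewrite /b map_mxM -adjmx_map -[X in _ - X]P2 -{1}P1.
  apply: le_trans (mnorm_star_mul (map_mx (phioo n) a0) P) _.
  have a0_le := mnorm_le_add (map_mx (phioo n) a0) P.
  move: a0_le; rewrite -/c => a0_le.
  by rewrite -dE mulrC ler_pM ?addr_ge0 ?mnorm_ge0//; lra.
have b_le : mnorm b <= c + e by have := mnorm_le_add b P; rewrite -/c; lra.
have bb : mnorm (map_mx (phioo n) (a - a *m a)) < tau.
  rewrite map_mxB (map_mxM _ a a) -/b.
  have -> : b - b *m b = (b - P) - (b *m (b - P) + (b - P) *m P).
    by rewrite mulmxBr mulmxBl P2 addrA subrK opprB addrA subrK.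
  apply: le_lt_trans (mnormD _ _) _; rewrite mnormN.
  have le : (mnorm b + c) * mnorm (b - P) <= (2 * c + 1) * e.
    by rewrite ler_pM ?addr_ge0 ?mnorm_ge0//; lra.
  have := mnormD (b *m (b - P)) ((b - P) *m P).
  by have := mnormM b (b - P); have := mnormM (b - P) P; rewrite -/c; lra.
have b_lt : mnorm b < c + 2 by lra.
have [k _ /(_ k (leqnn k))[k1 k2]] := filterI (mnorm_conn b_lt) (mnorm_conn bb).
pose ak : 'M[st (k + n)]_s := map_mx (conn n k) a.
have ak_adj : adjmx ak = ak.
  by rewrite adjmx_map /a adjmxM adjmxK.
have akE : ak - ak * ak = map_mx (conn n k) (a - a *m a).
  by rewrite map_mxB (map_mxM _ a a).
have ak_le : mnorm (ak - ak * ak) <= tau by rewrite akE; exact: ltW k2.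
have [p [pP pak]] := ex_near_projmx ak_adj (le_trans ak_le tau32).
have {}pak := le_trans pak (aux _ _ (mnorm_ge0 _) (ltW k1) (mnorm_ge0 _) ak_le).
exists (k + n)%N, (MatProj (A := stage S (k + n)) pP).
apply: (@close_projmx_mvn _ A s P _ Pp
  (mpmap_subproof (phioo (k + n)%N) (MatProj (A := stage S (k + n)) pP))).
rewrite mnormB; apply: le_trans (mnorm_dist b _ _) _.
apply: le_trans (lerD _ bP) e64; apply: le_trans pak.
have -> : b = map_mx (phioo (k + n)%N) (ak : 'M[stage S (k + n)]_s).
  by apply/matrixP => i j; rewrite !mxE phioo_conn.
rewrite /= -map_mxB; exact: mnorm_phioo.
Qed.

End DirectLimit.

(** * The map gamma *)

Lemma mpmap_comp (C : numClosedFieldType) (A B D : starAlgType C)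
    (g : starHom B D) (f : starHom A B) (p : matproj A) :
  mpmap (starHom_comp g f) p = mpmap g (mpmap f p).
Proof. by apply: matproj_eq; rewrite /= map_mx_comp. Qed.

Lemma mpmap_id (C : numClosedFieldType) (A : starAlgType C) (p : matproj A) :
  mpmap (starHom_id A) p = p.
Proof. by case: p => n M Mp; apply: matproj_eq; rewrite map_mx_id. Qed.

Lemma groth_classB (V : nmodType) (a b c d : V) :
  groth_class a b - groth_class c d = groth_class (a + d) (b + c) :> groth V.
Proof. by rewrite -[LHS]/(groth_add _ (groth_opp _)) groth_oppE groth_addE. Qed.

Section LimitGroup.
Variables (R : realType) (S : system R 2) (A : cstarAlg R).
Variables (phioo : forall n, starHom (stage S n) A) (c l : nat -> nat).
Hypotheses (hA : sys_limit phioo) (h1 : forall j, rr S j 0 = 1%N)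
  (h2 : forall j, contractible R (sp S j)) (h3 : sys_diagonal S)
  (h4 : forall n, (1 <= n)%N -> forall k j,
     mu S k j n = if k == j then (l n - c n)%N else c n)
  (h5 : forall n, (1 <= n)%N -> (2 * c n + 1 <= l n)%N).

Definition rprod n : nat := \prod_(1 <= k < n.+1) l k.
Definition rprod' n : nat := \prod_(1 <= k < n.+1) (l k - 2 * c k).
Local Notation r := rprod.
Local Notation r' := rprod'.
Local Notation stage_rank := (stage_rank h2).
Local Notation st := (stage_cstar h2).

Lemma rprodS n : r n.+1 = (r n * l n.+1)%N.
Proof. by rewrite /rprod big_nat_recr. Qed.

Lemma rprod'S n : r' n.+1 = (r' n * (l n.+1 - 2 * c n.+1))%N.
Proof. by rewrite /rprod' big_nat_recr. Qed.

Lemma rprod_gt0 n : (0 < r n)%N.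
Proof.
elim: n => [|n IHn]; first by rewrite /rprod big_geq.
by rewrite rprodS muln_gt0 IHn; have := h5 (ltn0Sn n); lia.
Qed.

Lemma rprod'_gt0 n : (0 < r' n)%N.
Proof.
elim: n => [|n IHn]; first by rewrite /rprod' big_geq.
by rewrite rprod'S muln_gt0 IHn; have := h5 (ltn0Sn n); lia.
Qed.

Definition rank_value n (a b : int) : rat * rat :=
  ((a + b)%:~R / (2 * r n)%:R, (a - b)%:~R / (2 * r' n)%:R).

Lemma rank_valueB n (a b a' b' : int) :
  rank_value n a b - rank_value n a' b' = rank_value n (a - a') (b - b').
Proof.
apply: (congr2 pair) => /=; rewrite -mulrBl -intrB; congr (_%:~R / _); lia.
Qed.

Definition proj_value n (p : matproj (stage S n)) : rat * rat :=
  rank_value n (stage_rank p ord0)%:Z (stage_rank p ord_max)%:Z.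

Lemma big_ord2 (F : 'I_2 -> nat) : (\sum_j F j = F ord0 + F ord_max)%N.
Proof.
rewrite big_ord_recr big_ord1 /=; congr (F _ + _)%N; exact: val_inj.
Qed.

Lemma proj_value_step n (p : matproj (stage S n)) :
  proj_value (mpmap (sys_map S n) p) = proj_value p.
Proof.
(* Since [2 c < l], the truncated subtractions are genuine and both cancelled factors are
   nonzero. *)
have hn := h5 (ltn0Sn n); have r0 := rprod_gt0 n; have r'0 := rprod'_gt0 n.
have l0 : (0 < l n.+1)%N by lia.
have lc0 : (0 < l n.+1 - 2 * c n.+1)%N by lia.
rewrite /proj_value /rank_value !sys_map_rank// !big_ord2 !h4//=.
set a := stage_rank p ord0; set b := stage_rank p ord_max.
congr (_, _).
  have -> : (((l n.+1 - c n.+1) * a + c n.+1 * b)%N%:Z +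
    (c n.+1 * a + (l n.+1 - c n.+1) * b)%N%:Z) = (l n.+1)%:Z * (a%:Z + b%:Z) by nia.
  rewrite rprodS mulnA (mulnC _ (l n.+1)) natrM intrM.
  by rewrite -mulf_div divff ?mul1r// pnatr_eq0 -lt0n.
have -> : (((l n.+1 - c n.+1) * a + c n.+1 * b)%N%:Z -
  (c n.+1 * a + (l n.+1 - c n.+1) * b)%N%:Z) =
  (l n.+1 - 2 * c n.+1)%N%:Z * (a%:Z - b%:Z) by nia.
rewrite rprod'S mulnA (mulnC _ (_ - _)%N) natrM intrM.
by rewrite -mulf_div divff ?mul1r// pnatr_eq0 -lt0n.
Qed.

Lemma proj_value_conn n k (p : matproj (stage S n)) :
  proj_value (mpmap (conn S n k) p) = proj_value p.
Proof.
elim: k => [|k IHk]; first by rewrite mpmap_id.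
by rewrite /= mpmap_comp proj_value_step.
Qed.

Lemma proj_value_inj n (p q : matproj (stage S n)) :
  proj_value p = proj_value q -> stage_rank p =1 stage_rank q.
Proof.
have r0 : (2 * r n)%:R != 0 :> rat by rewrite pnatr_eq0; have := rprod_gt0 n; lia.
have r'0 : (2 * r' n)%:R != 0 :> rat by rewrite pnatr_eq0; have := rprod'_gt0 n; lia.
rewrite /proj_value => -[/(divIf r0)/intr_inj e1 /(divIf r'0)/intr_inj e2].
have [e3 e4] : stage_rank p ord0 = stage_rank q ord0 /\
    stage_rank p ord_max = stage_rank q ord_max by lia.
move=> j; have [->|->] : j = ord0 \/ j = ord_max.
  by case: j => -[|[|//]] hj; [left|right]; exact: val_inj.
all: done.
Qed.

Lemma proj_value_mpsum n (p q : matproj (stage S n)) :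
  proj_value (mpsum p q) = proj_value p + proj_value q.
Proof.
rewrite /proj_value /rank_value !stage_rank_mpsum !PoszD /=.
rewrite -[RHS]/(_ + _, _ + _) -!mulrDl -!intrD.
by congr (_%:~R / _, _%:~R / _); lia.
Qed.

Lemma proj_lift n N (p : matproj (stage S n)) : (n <= N)%N ->
  exists p' : matproj (stage S N), mpmap (phioo N) p' = mpmap (phioo n) p /\
    proj_value p' = proj_value p.
Proof.
move=> /subnK <-; exists (mpmap (conn S n (N - n)) p).
rewrite proj_value_conn; split=> //; apply: matproj_eq.
by apply/matrixP => i j; rewrite !mxE phioo_conn.
Qed.

(** Equivalence in the limit forces equal ranks at a later stage, and the value is unchanged on the
    way there. Conversely, equal values give equal ranks, and then [p] and [q] are equivalent at
    stage [n] itself. *)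
Lemma phioo_mvnP n (p q : matproj (stage S n)) :
  mvn_equivalent (mpmap (phioo n) p) (mpmap (phioo n) q) <->
  proj_value p = proj_value q.
Proof.
split=> [/(phioo_mvn_rank h2 hA)[k [i pq]]|/proj_value_inj pq].
  rewrite -(proj_value_conn i p) -(proj_value_conn k) /proj_value !pq.
  by rewrite -/(proj_value _) !proj_value_conn.
by apply: mpmap_mvn; exact: stage_mvn pq.
Qed.

Lemma proj_value_unique n n' (p : matproj (stage S n)) (q : matproj (stage S n')) :
  mvn_equivalent (mpmap (phioo n) p) (mpmap (phioo n') q) ->
  proj_value p = proj_value q.
Proof.
have [p1 [<- <-]] := proj_lift p (leq_maxl n n').
have [q1 [<- <-]] := proj_lift q (leq_maxr n n').
by move/phioo_mvnP.
Qed.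

Lemma mvn_phioo_ex (x : mvn A) : exists n (p : matproj (stage S n)),
  x = mvn_class (mpmap (phioo n) p).
Proof.
elim/mvn_ind: x => P; have [n [p Pp]] := phioo_proj_approx h2 h3 hA P.
by exists n, p; exact/mvn_classP.
Qed.

Lemma mvn_phioo_ex2 (x y : mvn A) : exists n (p q : matproj (stage S n)),
  x = mvn_class (mpmap (phioo n) p) /\ y = mvn_class (mpmap (phioo n) q).
Proof.
have [n [p ->]] := mvn_phioo_ex x; have [n' [q ->]] := mvn_phioo_ex y.
have [p1 [<- _]] := proj_lift p (leq_maxl n n').
have [q1 [<- _]] := proj_lift q (leq_maxr n n').
by exists (maxn n n'), p1, q1.
Qed.

Lemma mvn_value_ex (x : mvn A) : exists z n (p : matproj (stage S n)),
  x = mvn_class (mpmap (phioo n) p) /\ z = proj_value p.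
Proof. by have [n [p xp]] := mvn_phioo_ex x; exists (proj_value p), n, p. Qed.

(** A representative at some stage is chosen; [mvn_valueE] shows that the choice does not matter. *)
Definition mvn_value (x : mvn A) : rat * rat := projT1 (cid (mvn_value_ex x)).

Lemma mvn_valueE n (p : matproj (stage S n)) :
  mvn_value (mvn_class (mpmap (phioo n) p)) = proj_value p.
Proof.
have [n' [q [/mvn_classP pq qE]]] := projT2 (cid (mvn_value_ex
  (mvn_class (mpmap (phioo n) p)))).
by rewrite [LHS]qE; apply: proj_value_unique; exact: mvn_equivalent_sym.
Qed.

Lemma mvn_valueD x y : mvn_value (x + y) = mvn_value x + mvn_value y.
Proof.
have [n [p [q [-> ->]]]] := mvn_phioo_ex2 x y.
have -> : mvn_class (mpmap (phioo n) p) + mvn_class (mpmap (phioo n) q) =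
    mvn_class (mpmap (phioo n) (mpsum p q)).
  by rewrite -!mvn_mapE -mvn_mapD [X in mvn_map _ X]mvn_addE.
by rewrite !mvn_valueE proj_value_mpsum.
Qed.

Lemma mvn_value_inj : injective mvn_value.
Proof.
move=> x y; have [n [p [q [-> ->]]]] := mvn_phioo_ex2 x y.
by rewrite !mvn_valueE => pq; apply/mvn_classP/phioo_mvnP.
Qed.

Definition K0_value (x : K0 A) : rat * rat :=
  mvn_value (repr (x : groth (mvn A))).1 - mvn_value (repr (x : groth (mvn A))).2.

Lemma K0_valueE (a b : mvn A) :
  K0_value (groth_class a b) = mvn_value a - mvn_value b.
Proof.
have [s e] := repr_groth_class a b; rewrite /K0_value.
have := congr1 mvn_value e; rewrite !mvn_valueD => /addIr e'.
by apply/eqP; rewrite subr_eq addrAC -e' addrK.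
Qed.

Fact K0_value_zmod : zmod_morphism K0_value.
Proof.
elim/groth_ind=> a b; elim/groth_ind=> a' b'.
by rewrite groth_classB !K0_valueE !mvn_valueD [in RHS]opprB opprD addrACA.
Qed.

(** [mvn_value] embeds [mvn A] additively into a group, so this monoid is cancellative and [0]
    serves as the stabilising summand. *)
Lemma K0_value_inj : injective K0_value.
Proof.
elim/groth_ind=> a b; elim/groth_ind=> a' b'; rewrite !K0_valueE => e.
apply/groth_classP; exists 0; rewrite !addr0; apply: mvn_value_inj.
move/eqP: e; rewrite subr_eq addrAC eq_sym subr_eq eq_sym => /eqP.
by rewrite !mvn_valueD.
Qed.

Lemma K0_value_gamma : is_gamma phioo r r' K0_value.
Proof.
move=> n x v [p [q [-> pq]]].
have vE j : v j = (stage_rank p j)%:Z - (stage_rank q j)%:Z.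
  by rewrite -(pq j (base_point h2 j n)).
rewrite K0_mapE K0_valueE !mvn_valueE !vE.
exact: rank_valueB.
Qed.

Lemma K0_phioo_ex (x : K0 A) : exists n (p q : matproj (stage S n)),
  x = K0_map (phioo n) (K0_class p q).
Proof.
elim/groth_ind: x => a b; have [n [p [q [-> ->]]]] := mvn_phioo_ex2 a b.
by exists n, p, q; rewrite K0_mapE.
Qed.

(** Every element of [K0 A] comes from a stage, and there it has a rank vector because ranks are
    constant over each space. *)
Lemma is_gamma_unique (f g : K0 A -> rat * rat) :
  is_gamma phioo r r' f -> is_gamma phioo r r' g -> f =1 g.
Proof.
move=> fg gg x; have [n [p [q ->]]] := K0_phioo_ex x.
pose v j := (stage_rank p j)%:Z - (stage_rank q j)%:Z.
have rv : K0_has_rank (K0_class p q) v.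
  by exists p, q; split=> // j y; rewrite !(mprank_const h2).
by rewrite (fg _ _ _ rv) (gg _ _ _ rv).
Qed.

Lemma K0_value_unit : K0_value (K0_class mp1 (mp0 A)) = (1, 0).
Proof.
have -> : mp1 = mpmap (phioo 0) mp1 :> matproj A.
  by apply: matproj_eq; rewrite map_mx1.
have -> : mp0 A = mpmap (phioo 0) (mp0 _).
  by apply: matproj_eq; rewrite map_mx0.
rewrite K0_valueE !mvn_valueE.
have rk0 j : stage_rank (mp0 (stage S 0)) j = 0%N.
  apply/eqP; rewrite -(eqr_nat (Cplx R)).
  by rewrite (stage_rank_tr _ _ (base_point h2 j 0)) big_ord0.
have rk1 j : stage_rank (mp1 : matproj (stage S 0)) j = 1%N.
  apply/eqP; rewrite -(eqr_nat (Cplx R)).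
  rewrite (stage_rank_tr _ _ (base_point h2 j 0)) big_ord1 mxE /=.
  by rewrite [\tr _]mxtrace1 h1.
by rewrite /proj_value /rank_value !rk0 !rk1 /rprod /rprod' !big_geq.
Qed.

(** * Order and surjectivity *)

Hypotheses (hc : forall n, (1 <= n)%N -> (0 < c n)%N)
  (hdiv : forall k, (0 < k)%N -> exists n n',
      [/\ (1 <= n)%N, (1 <= n')%N, (k %| r n)%N & (k %| r' n')%N]).

Definition ratio n : R := \prod_(1 <= k < n.+1) (1 - (2 * c k)%:R / (l k)%:R).
Local Notation lambda := (limn ratio).

Lemma ratioE n : ratio n = (r' n)%:R / (r n)%:R.
Proof.
elim: n => [|n IHn]; first by rewrite /ratio /rprod /rprod' !big_geq// divr1.
have hn := h5 (ltn0Sn n).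
have l0 : (l n.+1)%:R != 0 :> R by rewrite pnatr_eq0; lia.
rewrite /ratio big_nat_recr//= -/(ratio n) IHn rprodS rprod'S !natrM -mulf_div.
congr (_ * _); rewrite natrB; last by lia.
by rewrite mulrBl divff// natrM.
Qed.

Lemma ratio_gt0 n : 0 < ratio n.
Proof. by rewrite ratioE divr_gt0// ltr0n ?rprod_gt0 ?rprod'_gt0. Qed.

Lemma ratioS n : ratio n.+1 < ratio n.
Proof.
rewrite /ratio big_nat_recr//= -/(ratio n) gtr_pMr ?ratio_gt0// gtrBl.
have := h5 (ltn0Sn n); have := hc (ltn0Sn n) => ? ?.
by rewrite divr_gt0// ltr0n; lia.
Qed.

Lemma ratio_nonincreasing : {homo ratio : n m / (n <= m)%N >-> m <= n}.
Proof. by apply/nonincreasing_seqP => n; rewrite ltW// ratioS. Qed.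

Lemma ratio_cvg : cvgn ratio.
Proof.
apply: nonincreasing_is_cvgn; first exact: ratio_nonincreasing.
by exists 0 => _ [n _ <-]; exact/ltW/ratio_gt0.
Qed.

(** Strictness comes from one more factor: [lambda <= ratio n.+1 < ratio n]. *)
Lemma lambda_lt n : lambda < ratio n.
Proof.
apply: le_lt_trans (ratioS n).
exact: nonincreasing_cvgn_ge ratio_nonincreasing ratio_cvg _.
Qed.

Lemma rprod_dvd n n' : (n <= n')%N -> (r n %| r n')%N.
Proof.
elim: n' => [|n' IHn']; first by rewrite leqn0 => /eqP ->.
by rewrite leq_eqVlt => /predU1P[->//|/IHn' h]; rewrite rprodS dvdn_mulr.
Qed.

Lemma rprod'_dvd n n' : (n <= n')%N -> (r' n %| r' n')%N.
Proof.
elim: n' => [|n' IHn']; first by rewrite leqn0 => /eqP ->.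
by rewrite leq_eqVlt => /predU1P[->//|/IHn' h]; rewrite rprod'S dvdn_mulr.
Qed.

Lemma mul_denq_int (a : rat) (k : nat) : (`|denq a| %| k)%N ->
  exists z : int, z%:~R = k%:R * a.
Proof.
move=> /dvdnP[q ->]; exists (q%:Z * numq a).
rewrite natrM -mulrA intrM; congr (_ * _).
by rewrite natr_absz normr_denq numqE mulrC.
Qed.

Lemma proj_value_order n (p : matproj (stage S n)) :
  proj_value p = (0, 0) \/
  lambda * `|ratr (proj_value p).2| < ratr (proj_value p).1 :> R.
Proof.
set a := stage_rank p ord0; set b := stage_rank p ord_max.
have r0 : 0 < (r n)%:R :> R by rewrite ltr0n rprod_gt0.
have r'0 : 0 < (r' n)%:R :> R by rewrite ltr0n rprod'_gt0.
have [ab0|ab0] := posnP (a + b).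
  left; have [a0 b0] : a = 0%N /\ b = 0%N by lia.
  by rewrite /proj_value /rank_value -/a -/b a0 b0 !mul0r.
right; rewrite /proj_value /rank_value -/a -/b /= !fmorph_div /=.
rewrite !ratr_int !ratr_nat normrM normfV [`|_%:R|]ger0_norm ?ler0n// -intr_norm.
have abn : (`|a%:Z - b%:Z| <= a%:Z + b%:Z)%R by lia.
(* For equal ranks strictness comes from [a + b > 0]. Otherwise it comes from [lambda < ratio n],
   which needs a nonzero second coordinate. *)
have [d0|d0] := eqVneq (a%:Z - b%:Z) 0.
  by rewrite d0 normr0 mul0r mulr0 divr_gt0// ?ltr0z ?ltr0n ?muln_gt0 ?rprod_gt0//; lia.
have d_gt0 : 0 < `|a%:Z - b%:Z|%:~R / (2 * r' n)%:R :> R.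
  by rewrite divr_gt0 ?ltr0z ?normr_gt0 ?ltr0n ?muln_gt0 ?rprod'_gt0.
apply: (@lt_le_trans _ _ (ratio n * (`|a%:Z - b%:Z|%:~R / (2 * r' n)%:R))).
  by rewrite ltr_pM2r ?lambda_lt.
rewrite ratioE !natrM.
have -> : (r' n)%:R / (r n)%:R * (`|a%:Z - b%:Z|%:~R / (2 * (r' n)%:R)) =
    `|a%:Z - b%:Z|%:~R / (2 * (r n)%:R) :> R.
  by field; rewrite !gt_eqF.
by rewrite ler_pM2r ?invr_gt0 ?mulr_gt0// ler_int.
Qed.

Lemma proj_value_ex (a b : rat) : lambda * `|ratr b| < ratr a ->
  exists n (p : matproj (stage S n)), proj_value p = (a, b).
Proof.
move=> ab.
have cv : ratio n * `|ratr b| @[n --> \oo] --> lambda * `|ratr b|.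
  by apply: cvgMr_tmp; exact: ratio_cvg.
have [N1 _ N1P] := cvgr_lt _ cv _ ab.
have K0 : (0 < `|denq a| * `|denq b|)%N by rewrite muln_gt0 !absz_gt0 !denq_neq0.
have [n1 [n2 [_ _ n1P n2P]]] := hdiv K0.
(* Beyond [N1] the hypothesis holds with [ratio n] in place of [lambda]. Beyond [n1] and [n2] the
   numbers [r n] and [r' n] clear the denominators, as each product divides the later ones. *)
pose n := maxn N1 (maxn n1 n2).
have [za zaE] : exists z : int, z%:~R = (r n)%:R * a.
  apply: mul_denq_int; have n1n : (n1 <= n)%N by rewrite /n; lia.
  apply: dvdn_trans (rprod_dvd n1n).
  exact: dvdn_trans (dvdn_mulr _ (dvdnn _)) n1P.
have [zb zbE] : exists z : int, z%:~R = (r' n)%:R * b.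
  apply: mul_denq_int; have n2n : (n2 <= n)%N by rewrite /n; lia.
  apply: dvdn_trans (rprod'_dvd n2n).
  exact: dvdn_trans (dvdn_mull _ (dvdnn _)) n2P.
have r0 : 0 < (r n)%:R :> R by rewrite ltr0n rprod_gt0.
have zab : (`|zb| <= za)%R.
  rewrite -(ler_int R) intr_norm -(ratr_int R zb) -(ratr_int R za) zaE zbE.
  rewrite !rmorphM !rmorph_nat normrM ger0_norm ?ler0n//.
  have := ltW (N1P n (leq_maxl _ _)); rewrite /= ratioE mulrAC ler_pdivrMr//.
  by rewrite (mulrC (ratr a)).
(* The ranks [za + zb] and [za - zb] are nonnegative by [zab]. Their sum and difference are [2 za]
   and [2 zb], so the factor [2] in the definition of gamma removes any parity condition. *)
have [p pE] := stage_rank_ex h2 n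
  (fun j => if j == ord0 then absz (za + zb) else absz (za - zb)).
exists n, p; rewrite /proj_value /rank_value !pE /=.
have -> : (absz (za + zb))%:Z + (absz (za - zb))%:Z = 2 * za by lia.
have -> : (absz (za + zb))%:Z - (absz (za - zb))%:Z = 2 * zb by lia.
have rn0 : (r n)%:R != 0 :> rat by rewrite pnatr_eq0 -lt0n rprod_gt0.
have r'n0 : (r' n)%:R != 0 :> rat by rewrite pnatr_eq0 -lt0n rprod'_gt0.
by rewrite !intrM zaE zbE !natrM; congr (_, _); field.
Qed.

Lemma mvn_value_ex_pos (z : rat * rat) : lambda * `|ratr z.2| < ratr z.1 ->
  exists x : mvn A, mvn_value x = z.
Proof.
case: z => a b /= /proj_value_ex[n [p pE]].
by exists (mvn_class (mpmap (phioo n) p)); rewrite mvn_valueE.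
Qed.

Lemma mvn_value0 : mvn_value 0 = 0.
Proof. by apply: (addrI (mvn_value 0)); rewrite -mvn_valueD !addr0. Qed.

(** The pair is the difference of [(a + M, b)] and [(M, 0)]. Both are strictly positive for
    [M = |a| + |b| + 1], because [lambda < ratio 0 = 1]. *)
Lemma K0_value_surj (z : rat * rat) : exists x, K0_value x = z.
Proof.
case: z => a b; pose M := `|a| + `|b| + 1.
have lam1 : lambda < 1.
  by apply: lt_le_trans (lambda_lt 0) _; rewrite /ratio big_geq.
have M0 : 0 < M by rewrite ltr_wpDl// addr_ge0.
have [x xE] : exists x : mvn A, mvn_value x = (a + M, b).
  apply: mvn_value_ex_pos => /=; apply: (@le_lt_trans _ _ `|ratr b|).
    by rewrite ler_piMl// ltW.
  rewrite -ratr_norm ltr_rat /M; have := ler_norm (- a); rewrite normrN; lra.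
have [y yE] : exists y : mvn A, mvn_value y = (M, 0).
  by apply: mvn_value_ex_pos => /=; rewrite rmorph0 normr0 mulr0 ltr0q.
exists (groth_class x y); rewrite K0_valueE xE yE.
by apply: (congr2 pair) => /=; rewrite ?addrK ?subr0.
Qed.

Lemma K0_value_pos (x : K0 A) :
  (exists p, x = K0_class p (mp0 A)) <->
  (K0_value x = (0, 0) \/ lambda * `|ratr (K0_value x).2| < ratr (K0_value x).1).
Proof.
have v0 (y : mvn A) : K0_value (groth_class y 0) = mvn_value y.
  by rewrite K0_valueE mvn_value0 subr0.
split=> [[p ->]|h].
  rewrite v0; have [n [q ->]] := mvn_phioo_ex (mvn_class p).
  by rewrite mvn_valueE; exact: proj_value_order.
suff [y yE] : exists y : mvn A, mvn_value y = K0_value x.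
  elim/mvn_ind: y yE => p; rewrite -v0 => /K0_value_inj <-.
  by exists p.
case: h => [->|/mvn_value_ex_pos//]; exists 0; exact: mvn_value0.
Qed.

End LimitGroup.

Theorem lemma2p4 (R : realType) (S : system R 2) (A : cstarAlg R)
    (phioo : forall n, starHom (stage S n) A) (c l : nat -> nat)
    (hA : sys_limit phioo)
    (h1 : forall j, rr S j 0 = 1%N)
    (h2 : forall j, contractible R (sp S j))
    (h3 : sys_diagonal S)
    (hc : forall n, (1 <= n)%N -> (0 < c n)%N)
    (hl : forall n, (1 <= n)%N -> (0 < l n)%N)
    (h4 : forall n, (1 <= n)%N -> forall k j,
        mu S k j n = if k == j then (l n - c n)%N else c n)
    (h5 : forall n, (1 <= n)%N -> (2 * c n + 1 <= l n)%N) :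
  let r n := (\prod_(1 <= k < n.+1) l k)%N in
  let r' n := (\prod_(1 <= k < n.+1) (l k - 2 * c k))%N in
  let lambda : R :=
    limn (fun n => \prod_(1 <= k < n.+1) (1 - (2 * c k)%:R / (l k)%:R) : R) in
  (forall k, (0 < k)%N -> exists n n',
      [/\ (1 <= n)%N, (1 <= n')%N, (k %| r n)%N & (k %| r' n')%N]) ->
  (forall N, exists n, (N <= n)%N /\ (0 < c n)%N) ->
  exists gamma : {additive K0_scaled A -> QQ_scaled lambda},
    [/\ is_gamma phioo r r' gamma,
        (forall gamma' : {additive K0_scaled A -> QQ_scaled lambda},
           is_gamma phioo r r' gamma' -> gamma' =1 gamma) &
        scaled_group_iso gamma].
Proof.
move=> r r' lambda hdiv _.
pose f : K0_scaled A -> QQ_scaled lambda := K0_value c l hA h2 h3.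
have fB : zmod_morphism f := K0_value_zmod hA h2 h3 h4 h5.
pose gamma : {additive K0_scaled A -> QQ_scaled lambda} :=
  HB.pack f (GRing.isZmodMorphism.Build (K0_scaled A) (QQ_scaled lambda) f fB).
have gammaP : is_gamma phioo r r' gamma := K0_value_gamma hA h2 h3 h4 h5.
exists gamma; split=> // [gamma' gamma'P|].
  exact: (is_gamma_unique hA h2 h3 h4 h5 gamma'P gammaP).
split.
(* Chosen preimages give a right inverse, which injectivity makes two-sided. *)
- have /choice[g gK] : forall z, exists x, f x = z.
    exact: (K0_value_surj hA h2 h3 h4 h5 hc hdiv).
  exists g => x; last exact: gK.
  by apply: (K0_value_inj h4 h5 (hA := hA) (h2 := h2) (h3 := h3)); exact: (gK (f x)).
- exact: (K0_value_pos hA h2 h3 h4 h5 hc hdiv).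
- exact: (K0_value_unit hA h1 h2 h3 h4 h5).
Qed.
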